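(* Let $(U,V)$ be a bivariate normal random vector with zero mean vector, variances $(\sigma_U^2,\sigma_V^2)$ with $\sigma_U,\sigma_V>0$, and correlation coefficient $\rho\in(-1,1)$. Set $s=\sigma_U\sigma_V$ and $Z=UV$. Let $n\geq1$ be an integer, let $Z_1,\ldots,Z_n$ be independent copies of $Z$, and let $\overline{Z}_n=n^{-1}(Z_1+Z_2+\cdots+Z_n)$. Then, for every real $k>-1$, $$\mathbb{E}[|\overline{Z}_n|^k]=\frac{(2s/n)^k(1-\rho^2)^{n/2+k}}{\sqrt{\pi}\,\Gamma(n/2)}\,\Gamma\Big(\frac{n+k}{2}\Big)\Gamma\Big(\frac{k+1}{2}\Big)\,{}_2F_1\bigg(\frac{k+1}{2},\frac{n+k}{2};\frac{1}{2};\rho^2\bigg),$$ whilst, for every positive integer $k$, with $\ell:=\lceil k/2\rceil+1/2$ and $m:=k\bmod 2\in\{0,1\}$, $$\mathbb{E}[\overline{Z}_n^k]=\frac{(2s/n)^k(2\rho)^m(1-\rho^2)^{n/2+k}}{\sqrt{\pi}\,\Gamma(n/2)}\,\Gamma\Big(\frac{n-1}{2}+\ell\Big)\Gamma(\ell)\,{}_2F_1\bigg(\ell,\frac{n-1}{2}+\ell;\frac{1}{2}+m;\rho^2\bigg).$$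
   Context: The Gaussian hypergeometric function is defined for $|x|<1$ by $${}_2F_1(a,b;c;x)=\sum_{j=0}^\infty\frac{(a)_j(b)_j}{(c)_j}\frac{x^j}{j!},$$ where $(u)_j=u(u+1)\cdots(u+j-1)$ is the ascending factorial, with $(u)_0=1$. The convention $(2\rho)^0=1$ is used, including when $\rho=0$. *)

(* Defs.v *)
From HB Require Import structures.
From mathcomp Require Import all_boot all_order all_algebra.
From mathcomp Require Import all_classical all_reals all_analysis.

Set Implicit Arguments.
Unset Strict Implicit.
Unset Printing Implicit Defensive.

Import Order.TTheory GRing.Theory Num.Theory.
Import numFieldNormedType.Exports.

Local Open Scope classical_set_scope.
Local Open Scope ring_scope.

(* Euler's integral; it converges, and so has its classical value, exactly
   when 0 < x. *)
Definition Gamma (R : realType) (x : R) : R :=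
  \int[lebesgue_measure]_(t in `]0, +oo[) (t `^ (x - 1) * expR (- t)).

Definition ascending_factorial (R : realType) (u : R) (j : nat) : R :=
  \prod_(i < j) (u + i%:R).

(* Only meaningful for `|x| < 1 and c not in {0, -1, -2, ...}. *)
Definition hypergeometric2F1 (R : realType) (a b c x : R) : R :=
  limn (series (fun j : nat =>
    ascending_factorial a j * ascending_factorial b j / ascending_factorial c j
    * (x ^+ j / j`!%:R))).

(* The density of the nondegenerate bivariate normal law with means m1, m2,
   standard deviations s1, s2 > 0 and correlation coefficient -1 < rho < 1. *)
Definition bivariate_normal_pdf (R : realType) (m1 m2 s1 s2 rho : R)
    (z : R * R) : R :=
  let x := (z.1 - m1) / s1 in
  let y := (z.2 - m2) / s2 in
  (2 * pi * s1 * s2 * Num.sqrt (1 - rho ^+ 2))^-1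
  * expR (- (x ^+ 2 - 2 * rho * x * y + y ^+ 2) / (2 * (1 - rho ^+ 2))).

Definition is_bivariate_normal d (T : measurableType d) (R : realType)
    (P : probability T R) (U V : T -> R) (m1 m2 s1 s2 rho : R) : Prop :=
  forall A : set (R * R), measurable A ->
    P ((fun w => (U w, V w)) @^-1` A) =
    (\int[(lebesgue_measure \x lebesgue_measure)%E]_(z in A)
       (bivariate_normal_pdf m1 m2 s1 s2 rho z)%:E)%E.

Definition identically_distributed d1 (T1 : measurableType d1)
    d2 (T2 : measurableType d2) (R : realType)
    (P1 : probability T1 R) (X1 : T1 -> R)
    (P2 : probability T2 R) (X2 : T2 -> R) : Prop :=
  forall B : set R, measurable B -> P1 (X1 @^-1` B) = P2 (X2 @^-1` B).

Definition mutually_independent d (T : measurableType d) (R : realType)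
    (P : probability T R) (I : finType) (X : I -> T -> R) : Prop :=
  forall (J : {set I}) (B : I -> set R),
    (forall i, measurable (B i)) ->
    P (\bigcap_(i in [set i | i \in J]) (X i @^-1` B i)) =
    (\prod_(i in J) P (X i @^-1` B i))%E.

Definition sample_mean (T : Type) (R : realType) (n : nat)
    (Z : 'I_n -> T -> R) (w : T) : R :=
  n%:R^-1 * \sum_(i < n) Z i w.

(* Main.v *)
(* Dividing by tau = 2 s (1 - rho^2), the product law has density
   q |-> K(1/2) e^(2 rho q) G_(1/2)(q), where
   G_p(q) = int_0^oo w^(p - 3/2) e^(-w - q^2/w) dw and
   K(p) = (1 - rho^2)^p / (sqrt pi Gamma(p)): given U, the product UV is normal
   with mean and variance proportional to U^2, which plays the role of w.
   The tilt e^(2 rho q) is multiplicative, and Gaussian convolution followed by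
   the Beta integral shows that the densities K(p) e^(2 rho q) G_p(q) form a
   convolution semigroup in p; hence the sum of n copies has parameter p = n/2.
   For the moments one splits into q > 0 and q < 0, so that e^(2 rho q) becomes
   2 cosh or 2 sinh of 2 rho q, expands into a power series and integrates
   termwise: each term is a product of two Gamma values, and the sum is the
   hypergeometric series. Its convergence comes for free from the finiteness of
   the integral, as 2 |q| <= w + q^2/w. *)
Require Import Defs.
From HB Require Import structures.
From mathcomp Require Import all_boot all_order all_algebra.
From mathcomp Require Import all_classical all_reals all_analysis.
From mathcomp Require Import measurable_realfun.
From mathcomp Require Import ring lra zify.
Import Order.TTheory GRing.Theory Num.Theory.
Import numFieldNormedType.Exports.
Set Implicit Arguments.
Unset Strict Implicit.
Unset Printing Implicit Defensive.

Local Open Scope classical_set_scope.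
Local Open Scope ring_scope.

(** * Measures with a density *)

(** Origin of tau: put r^2 = 2 (1 - rho^2), u = s1 r x and v = s2 r q / x. Then u v = s1 s2 r^2 q =
    tau q, and the Gaussian exponent becomes -(x^2 - 2 rho q + q^2/x^2). The cross term does not
    depend on x, which is why the tilt e^(2 rho q) leaves the integral, and w = x^2. The constant
    K(p) is consistent because K(p) K(r) sqrt(pi) B(p, r) = K(p + r).

    Integrability is kept out of the way: laws, convolutions and the Gamma and Beta identities are
    stated for [0, +oo]-valued integrals over the whole line, so that Tonelli always applies.
    Finiteness is needed only to pass to the real-valued [Gamma], to the limit in
    [hypergeometric2F1], and to subtract the two halves of an odd moment.

    Substitutions are obtained without derivatives, from the uniqueness of Lebesgue measure on
    half-open intervals. The termwise expansion has nonnegative terms only for rho >= 0; negative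
    rho is reached by parity, the sum of the two halves being even in rho and their difference
    odd. *)

Section density_measure.
Local Open Scope ereal_scope.
Context d (T : measurableType d) (R : realType).
Variables (m : {measure set T -> \bar R}) (f : T -> \bar R).
Hypotheses (mf : measurable_fun [set: T] f) (f0 : forall x, 0 <= f x).

(** The two proofs are arguments so that the measure structure declared below, which depends on
    them, can be inferred from the term. *)
Definition density_measure (_ : measurable_fun [set: T] f) (_ : forall x, 0 <= f x)
  (A : set T) : \bar R := \int[m]_(x in A) f x.

Local Notation nu := (density_measure mf f0).

Let nu0 : nu set0 = 0. Proof. exact: integral_set0. Qed.
Let nu_ge0 A : 0 <= nu A. Proof. exact: integral_ge0. Qed.
Let nu_sigma_additive : semi_sigma_additive nu.
Proof.
move=> F mF tF mUF; rewrite /density_measure ge0_integral_bigcup//=; last first.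
  exact: measurable_funTS.
by apply: is_cvg_ereal_nneg_natsum_cond => n _ _; exact: integral_ge0.
Qed.

HB.instance Definition _ :=
  isMeasure.Build _ _ _ nu nu0 nu_ge0 nu_sigma_additive.

Import HBNNSimple.

Lemma integral_density_measure (h : T -> \bar R) :
  measurable_fun setT h -> (forall x, 0 <= h x) ->
  \int[nu]_x h x = \int[m]_x (h x * f x).
Proof.
move=> mh h0.
pose h_ := nnsfun_approx measurableT mh.
have cvh x : EFin (h_ n x) @[n --> \oo] --> h x by exact: cvg_nnsfun_approx.
transitivity (limn (fun n => \int[nu]_x (h_ n x)%:E)).
  rewrite -monotone_convergence//.
  - by apply: eq_integral => x _; apply/esym/cvg_lim.
  - by move=> n; exact/measurable_EFinP.
  - by move=> n x _; rewrite lee_fin.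
  - by move=> x _ a b ab; rewrite lee_fin; exact/lefP/nd_nnsfun_approx.
rewrite [X in limn X](_ : _ = (fun n => \int[m]_x ((h_ n x)%:E * f x))).
  rewrite -monotone_convergence//; last 3 first.
  - by move=> n; apply: emeasurable_funM => //; exact/measurable_EFinP.
  - by move=> n x _; rewrite mule_ge0// lee_fin.
  - move=> x _ a b ab; rewrite lee_wpmul2r// lee_fin.
    exact/lefP/nd_nnsfun_approx.
  apply: eq_integral => x _; apply/cvg_lim => //.
  case fx : (f x) => [r| |]; last by have := f0 x; rewrite fx.
    by apply: cvgeZr => //; exact: cvh.
  (* Here f x = +oo, and the product is discontinuous at 0 * +oo; but h x = 0 forces every
     approximant to vanish at x. *)
  have [hx0|hx0] := eqVneq (h x) 0.
    rewrite hx0 mul0e (_ : (fun n => _) = cst 0); first exact: cvg_cst.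
    apply/funext => n /=; suff -> : h_ n x = 0%R by rewrite mul0e.
    apply/eqP; rewrite eq_le fun_ge0 andbT -lee_fin -[leRHS]hx0.
    by rewrite nnsfun_approxE; exact: le_approx.
  apply: cvgeM; [|exact: cvh|exact: cvg_cst].
  exact: mule_def_neq0_infty.
apply/funext => n.
under [LHS]eq_integral do rewrite fimfunE -fsumEFin//.
rewrite ge0_integral_fsum//; last 2 first.
- by move=> y; exact/measurable_EFinP/measurable_funM.
- by move=> y x _; rewrite nnfun_muleindic_ge0.
under [RHS]eq_integral => x _.
  rewrite fimfunE -fsumEFin// ge0_mule_fsuml; last first.
    by move=> y; rewrite nnfun_muleindic_ge0.
  over.
rewrite ge0_integral_fsum//; last 2 first.
- by move=> y; apply: emeasurable_funM => //; exact/measurable_EFinP/measurable_funM.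
- by move=> y x _; rewrite mule_ge0// nnfun_muleindic_ge0.
apply: eq_fsbigr => r rhn.
have r0 : (0 <= r)%R by move: rhn; rewrite inE => -[x _ <-].
rewrite integralZl_indic_nnsfun// integral_indic// setIT.
under [RHS]eq_integral do rewrite EFinM -muleA.
rewrite ge0_integralZl_EFin//; last 2 first.
- by move=> x _; rewrite mule_ge0// lee_fin.
- by apply: emeasurable_funM => //; exact/measurable_EFinP.
congr (_ * _).
transitivity (\int[m]_(x in h_ n @^-1` [set r]) f x) => //.
rewrite integral_mkcond; apply: eq_integral => x _.
by rewrite patchE indicE; case: ifP => _; rewrite ?mul1e ?mul0e.
Qed.

End density_measure.

(** The existential form lets later proofs work with an opaque measure known only by its values and
    its integrals. *)
Lemma pushforward_measure_exists d1 d2 (T1 : measurableType d1)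
    (T2 : measurableType d2) (R : realType) (m : {measure set T1 -> \bar R})
    (phi : T1 -> T2) : measurable_fun [set: T1] phi ->
  exists m' : {measure set T2 -> \bar R},
    (forall A, m' A = m (phi @^-1` A)) /\
    (forall h : T2 -> \bar R, measurable_fun [set: T2] h ->
      (forall x, 0 <= h x)%E -> \int[m']_x h x = \int[m]_x h (phi x))%E.
Proof.
move=> mphi; unshelve eexists (pushforward m phi : {measure set _ -> \bar _}).
  exact: mphi.
by split=> // h mh h0; rewrite ge0_integral_pushforward// => x _; exact: h0.
Qed.

(** * Change of variables from the uniqueness of Lebesgue measure *)

Section change_of_variables.
Context (R : realType).
Local Notation mu := (@lebesgue_measure R).
Local Open Scope ereal_scope.

(** [f] plays the part of the Jacobian. Uniqueness concerns measures on the whole line, so the image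
    under [phi] of the measure with density [f], which lives on [D], is completed by Lebesgue
    measure on the complement of [D]. The sum has the right value on half-open intervals, hence is
    Lebesgue measure. *)
Lemma ge0_integral_change (phi : R -> R) (f : R -> \bar R) (D : set R)
    (h : R -> \bar R) :
  measurable_fun [set: R] phi -> measurable_fun [set: R] f ->
  (forall x, 0 <= f x) -> measurable D -> (forall x, D (phi x)) ->
  (forall a b : R, (a < b)%R ->
    \int[mu]_(x in phi @^-1` `]a, b]) f x = mu (`]a, b] `&` D)) ->
  measurable_fun [set: R] h -> (forall x, 0 <= h x) ->
  \int[mu]_x (h (phi x) * f x) = \int[mu]_(x in D) h x.
Proof.
move=> mphi mf f0 mD Dphi H mh h0.
have mphi' : measurable_fun [set: measurableTypeR R]
  (phi : measurableTypeR R -> measurableTypeR R) by exact: mphi.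
pose nu := density_measure mu mf f0.
have [m1 [m1E m1I]] := pushforward_measure_exists nu mphi'.
pose m : {measure set (measurableTypeR R) -> \bar R} :=
  measure_add m1 (mrestr mu (measurableC mD)).
have mE A : measurable A -> mu A = m A.
  apply: lebesgue_measure_unique => _ [[a b] _ <-].
  transitivity (m1 `]a, b]%classic + mu (`]a, b] `&` ~` D)); last first.
    exact/esym/measure_addE.
  have [ab|ba] := ltP a b; last first.
    by rewrite set_itv_ge ?bnd_simp -?leNgt// set0I !measure0 adde0.
  rewrite m1E [X in X + _](_ : _ = mu (`]a, b] `&` D)); last exact: H.
  rewrite /mrestr -measureU//; last 3 first.
  - exact: measurableI.
  - by apply: measurableI => //; exact: measurableC.
  - by rewrite setIACA setICr setI0.
  by rewrite -setIUr setUCr setIT.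
have mhD : measurable_fun [set: R] (h \_ D).
  by apply/(measurable_restrictT _ mD); exact: measurable_funTS.
have hD0 x : 0 <= (h \_ D) x by rewrite patchE; case: ifP.
under eq_integral => x _.
  rewrite (_ : h (phi x) = (h \_ D) (phi x)); last by rewrite patchE mem_set.
  over.
rewrite -integral_density_measure//; last by exact: measurableT_comp.
rewrite -m1I// -integral_mkcond.
have -> : \int[mu]_(x in D) h x = \int[m]_(x in D) h x.
  by apply: eq_measure_integral => A mA _; exact: mE.
rewrite ge0_integral_measure_add//; last exact: measurable_funTS.
(* The completing summand vanishes on every subset of [D]. *)
rewrite [X in _ + X](_ : _ = 0) ?adde0//.
rewrite (@eq_measure_integral _ _ _ _ mzero).
  by rewrite integral_measure_zero.
move=> A mA AD; rewrite /= /mrestr /mzero.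
by rewrite (_ : _ `&` _ = set0) ?measure0//; apply/disjoints_subset; rewrite setCK.
Qed.
End change_of_variables.

(** * Changes of variables on the real line *)

(* The power function on ]0, +oo[ extended by 0, so that integrals over the
   half-line become integrals over R (powR takes nonzero values at w < 0). *)
Definition ppow (R : realType) (a w : R) : R := if 0 < w then w `^ a else 0.

Section ppow.
Context (R : realType).
Implicit Types a b c w : R.

Lemma ppow_ge0 a w : 0 <= ppow a w.
Proof. by rewrite /ppow; case: ifP => // _; exact: powR_ge0. Qed.

Lemma ppow_pos a w : 0 < w -> ppow a w = w `^ a.
Proof. by rewrite /ppow => ->. Qed.

Lemma ppow_neg a w : w <= 0 -> ppow a w = 0.
Proof. by rewrite /ppow ltNge => ->. Qed.

Lemma ppowM a b w : ppow a w * ppow b w = ppow (a + b) w.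
Proof.
rewrite /ppow; case: ifP => w0; last by rewrite mul0r.
by rewrite powRD// (gt_eqF w0) implybT.
Qed.

Lemma ppowZ a c w : 0 < c -> ppow a (c * w) = c `^ a * ppow a w.
Proof.
move=> c0; rewrite /ppow pmulr_rgt0//; case: ifP => w0; last by rewrite mulr0.
by rewrite powRM// ltW.
Qed.

Lemma measurable_ppow a : measurable_fun [set: R] (ppow a).
Proof.
by apply: measurable_fun_ifT => //; exact: measurable_fun_ltr.
Qed.

Lemma ppow_expR a x : ppow a (expR x) = expR (a * x).
Proof. by rewrite ppow_pos ?expR_gt0// -expRM mulrC. Qed.

End ppow.


(** A measurability hypothesis in the context is used through composition; this is why later proofs
    introduce facts such as [mv] before calling [meas]. *)
Ltac meas_step :=
  match goal with
  | |- is_true (@Order.le _ _ _ (mule _ _)) => apply: mule_ge0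
  | |- is_true (@Order.le _ _ _ (EFin _)) => rewrite lee_fin
  | |- is_true (@Order.le _ _ _ (integral _ _ _)) => apply: integral_ge0 => ? _
  | |- is_true (@Order.le _ _ _ (GRing.mul _ _)) => apply: mulr_ge0
  | |- is_true (@Order.le _ _ _ (expR _)) => apply: expR_ge0
  | |- is_true (@Order.le _ _ _ (powR _ _)) => apply: powR_ge0
  | |- is_true (@Order.le _ _ _ (ppow _ _)) => apply: ppow_ge0
  | |- is_true (@Order.le _ _ _ (if _ then _ else _)) => case: ifP => _
  | |- forall _, _ => move=> ?
  | |- measurable_fun _ (ppow _) => apply: measurable_ppow
  | |- measurable_fun _ expR => apply: measurable_expR
  | |- measurable_fun _ (@Order.le _ _ _) => apply: measurable_fun_ler
  | |- measurable_fun _ (@Order.lt _ _ _) => apply: measurable_fun_ltr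
  | |- measurable_fun _ (EFin \o _) => apply/measurable_EFinP
  | |- measurable_fun _ (fun _ => (_)%:E) => apply/measurable_EFinP
  | |- measurable_fun _ (fun _ => (_ * _)%E) => apply: emeasurable_funM
  | |- measurable_fun _ (fun _ => (_ * _)%R) => apply: measurable_funM
  | |- measurable_fun _ (fun _ => (_ + _)%R) => apply: measurable_funD
  | |- measurable_fun _ (fun _ => (- _)%R) => apply: measurableT_comp
  | |- measurable_fun _ (fun _ => (_ ^+ _)%R) => apply: measurable_funX
  | |- measurable_fun _ (fun _ => expR _) =>
      apply: (measurableT_comp (@measurable_expR _))
  | |- measurable_fun _ (fun _ => ppow _ _) =>
      apply: (measurableT_comp (measurable_ppow _))
  | |- measurable_fun _ (fun _ => if _ then _ else _) =>
      apply: measurable_fun_ifT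
  | mh : measurable_fun _ ?h |- measurable_fun _ (fun _ => ?h _) =>
      apply: (measurableT_comp mh)
  | |- measurable_fun _ (fun _ => (_ < _)%R) => apply: measurable_fun_ltr
  | |- measurable_fun _ (fun _ => (_ <= _)%R) => apply: measurable_fun_ler
  end.
Ltac meas := repeat first [done | meas_step].

Section linear_and_exp_change.
Context (R : realType).
Local Notation mu := (@lebesgue_measure R).
Local Open Scope ereal_scope.
Implicit Types h : R -> \bar R.

Lemma ge0_integral_opp h : measurable_fun [set: R] h -> (forall x, 0 <= h x) ->
  \int[mu]_x h (- x)%R = \int[mu]_x h x.
Proof.
move=> mh h0; rewrite -(@ge0_integral_change _ -%R%R (cst 1) setT h)//.
  by apply: eq_integral => x _; rewrite mule1.
move=> a b ab; rewrite opp_preimage_itvbndbnd integral_cst// mul1e setIT.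
transitivity (b%:E - a%:E); last by rewrite lebesgue_measure_itv/= lte_fin ab.
by rewrite -[LHS]/(mu `[(- b)%R, (- a)%R[%classic) lebesgue_measure_itv/=
  lte_fin ltrN2 ab -!EFinB opprK addrC.
Qed.

Lemma ge0_integral_affine (c d : R) h : (0 < c)%R ->
  measurable_fun [set: R] h -> (forall x, 0 <= h x) ->
  \int[mu]_x h (c * x + d)%R = c^-1%:E * \int[mu]_x h x.
Proof.
move=> c0 mh h0.
rewrite -(@ge0_integral_change _ (fun x => c * x + d)%R (cst c%:E) setT h)//;
  first last.
- move=> a b ab.
  have -> : (fun x : R => (c * x + d)%R) @^-1` `]a, b] =
      `]((a - d) / c)%R, ((b - d) / c)%R]%classic.
    apply/seteqP; split => x /=; rewrite !in_itv/= => /andP[];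
    rewrite ltr_pdivrMr// ler_pdivlMr// ltrBlDr lerBrDr mulrC => -> ->//.
  rewrite integral_cst// setIT.
  transitivity (b%:E - a%:E); last by rewrite lebesgue_measure_itv/= lte_fin ab.
  rewrite -[X in _ * X]/(mu `]((a - d) / c)%R, ((b - d) / c)%R]%classic).
  rewrite lebesgue_measure_itv/= lte_fin ltr_pM2r ?invr_gt0// ltrD2r ab.
  rewrite -!EFinB -EFinM; congr (_%:E).
  by rewrite -mulrBl mulrCA divff ?gt_eqF// mulr1; ring.
- by move=> x; rewrite lee_fin ltW.
- by meas.
under [in RHS]eq_integral do rewrite muleC.
rewrite ge0_integralZl_EFin//; last 2 first.
- by meas.
- exact: ltW.
by rewrite muleA -EFinM mulVf ?gt_eqF// mul1e.
Qed.

Lemma ge0_integral_translate (d : R) h :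
  measurable_fun [set: R] h -> (forall x, 0 <= h x) ->
  \int[mu]_x h (x + d)%R = \int[mu]_x h x.
Proof.
move=> mh h0; under eq_integral => x _ do rewrite -[x in (x + d)%R](mul1r x).
by rewrite ge0_integral_affine// invr1 mul1e.
Qed.

(** The exponential density of rate 1 has mass 1; reflecting it and translating by c produces the
    factor e^c. *)
Lemma integral_expRNy (c : R) :
  \int[mu]_x (if (x <= c)%R then expR x else 0)%:E = (expR c)%:E.
Proof.
have H : \int[mu]_x (if (0 <= x)%R then expR (- x) else 0)%:E = 1.
  rewrite -(@integral_exponential_pdf R 1 ltr01); apply: eq_integral => x _.
  rewrite /exponential_pdf patchE; case: ifPn => x0; case: ifPn => //.
  - by rewrite mul1r mulN1r.
  - by rewrite notin_setE/= in_itv/= x0.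
  - by rewrite inE/= in_itv/= (negbTE x0).
rewrite -ge0_integral_opp; [|by meas..].
rewrite -(@ge0_integral_translate (- c)); [|by meas..].
rewrite -[RHS]mule1 -H -ge0_integralZl_EFin//; [|by meas ..].
apply: eq_integral => x _; rewrite -EFinM; congr EFin.
rewrite opprB lerBlDl lerDr; case: ifP; rewrite ?mulr0//.
by rewrite expRD.
Qed.

(** In the logarithmic variable, power substitutions on the half-line become affine ones. *)
Lemma ge0_integral_expR h : measurable_fun [set: R] h -> (forall x, 0 <= h x) ->
  \int[mu]_x (h (expR x) * (expR x)%:E) = \int[mu]_(x in `]0%R, +oo[) h x.
Proof.
move=> mh h0; apply: ge0_integral_change => //.
- by meas.
- by move=> x; rewrite /= in_itv/= andbT expR_gt0.
move=> a b ab.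
have [b0|b0] := leP b 0%R.
  rewrite (_ : _ @^-1` _ = set0); last first.
    apply/seteqP; split => x //=; rewrite in_itv/= => /andP[_].
    by rewrite leNgt (le_lt_trans b0)// expR_gt0.
  rewrite integral_set0 (_ : _ `&` _ = set0) ?measure0//.
  apply/seteqP; split => x //= []; rewrite !in_itv/= andbT => /andP[_ xb] x0.
  by have := lt_le_trans x0 (le_trans xb b0); rewrite ltxx.
(* Measure of ]0, c] in the logarithmic variable. The interval ]a, b] with a > 0 is then obtained as
   the difference of two such values. *)
have K c : (0 < c)%R -> \int[mu]_(x in `]-oo, ln c]) (expR x)%:E = c%:E.
  move=> c0; rewrite integral_mkcond -{2}(lnK c0) -integral_expRNy.
  apply: eq_integral => x _; rewrite patchE mem_setE in_itv/=.
  by case: ifP.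
have [a0|a0] := leP a 0%R.
  rewrite (_ : _ @^-1` _ = `]-oo, ln b]%classic); last first.
    apply/seteqP; split => x /=; rewrite !in_itv/=.
      by move=> /andP[_]; rewrite -{1}(lnK b0) ler_expR.
    by rewrite -ler_expR lnK// => ->; rewrite (le_lt_trans a0)// expR_gt0.
  rewrite K// (_ : _ `&` _ = `]0%R, b]%classic); last first.
    apply/seteqP; split => x /=; rewrite !in_itv/= andbT.
      by move=> [/andP[_ ->] ->].
    by move=> /andP[x0 ->]; rewrite x0 (le_lt_trans a0).
  by rewrite lebesgue_measure_itv/= lte_fin b0 oppr0 adde0.
rewrite (_ : _ @^-1` _ = `]ln a, ln b]%classic); last first.
  apply/seteqP; split => x /=; rewrite !in_itv/=.
    by rewrite -{1}(lnK a0) -{1}(lnK b0) ler_expR ltr_expR.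
  by rewrite -ler_expR -ltr_expR !lnK.
rewrite (_ : _ `&` _ = `]a, b]%classic); last first.
  apply/seteqP; split => x /=; rewrite !in_itv/= andbT.
    by move=> [].
  by move=> /andP[ax ->]; rewrite ax (lt_trans a0).
rewrite lebesgue_measure_itv/= lte_fin ab.
have := K b b0.
rewrite (_ : `]-oo, ln b]%classic =
    `]-oo, ln a]%classic `|` `]ln a, ln b]%classic); last first.
  rewrite -itv_bndbnd_setU ?bnd_simp//.
  by rewrite ler_ln ?posrE// ltW.
rewrite ge0_integral_setU//=.
- by move=> H; rewrite -[RHS]/(b%:E - a%:E) -H K// [X in X - _]addeC addeK.
- by apply: measurable_funTS; meas.
rewrite disj_set2E; apply/eqP; rewrite -subset0 => x []/=; rewrite !in_itv/=.
by move=> xa /andP[ax _]; rewrite ltNge xa in ax.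
Qed.

End linear_and_exp_change.

Section real_line_integrals.
Context (R : realType).
Local Notation mu := (@lebesgue_measure R).
Local Open Scope ereal_scope.
Implicit Types h : R -> \bar R.

(** Used at c = 0, where [ppow] and the indicator of a closed half-line follow different
    conventions. *)
Lemma eq_integral_except (c : R) (f g : R -> \bar R) :
  measurable_fun [set: R] f -> measurable_fun [set: R] g ->
  (forall x, x != c -> f x = g x) -> \int[mu]_x f x = \int[mu]_x g x.
Proof.
move=> mf mg fg; apply: ae_eq_integral => //.
exists [set c]; split; [exact: measurable_set1|exact: lebesgue_measure_set1|].
move=> x /= /not_implyP[_ fgx]; apply: contrapT => /eqP xc.
by apply: fgx; exact: fg.
Qed.

Lemma ge0_integral_pos h : measurable_fun [set: R] h -> (forall x, 0 <= h x) ->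
  (forall x, (x <= 0)%R -> h x = 0) ->
  \int[mu]_x h x = \int[mu]_x (h (expR x) * (expR x)%:E).
Proof.
move=> mh h0 hneg; rewrite ge0_integral_expR// [RHS]integral_mkcond.
apply: eq_integral => x _; rewrite patchE; case: ifPn => //.
by rewrite notin_setE/= in_itv/= andbT => /negP; rewrite -leNgt => /hneg.
Qed.

(** Squaring is doubling in the logarithmic variable. Writing the Jacobian 2 u with [ppow 1]
    restricts the right-hand side to u > 0. *)
Lemma ge0_integral_sqr h : measurable_fun [set: R] h -> (forall x, 0 <= h x) ->
  (forall x, (x <= 0)%R -> h x = 0) ->
  \int[mu]_x h x = \int[mu]_u (h (u ^+ 2)%R * (2 * ppow 1 u)%:E).
Proof.
move=> mh h0 hneg; rewrite ge0_integral_pos// [RHS]ge0_integral_pos; last 3 first.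
- by meas.
- by meas.
- by move=> x x0; rewrite ppow_neg// mulr0 mule0.
pose k x := h (expR x) * (expR x)%:E.
have mk : measurable_fun [set: R] k by rewrite /k; meas.
have k0 x : 0 <= k x by rewrite /k; meas.
transitivity (2%:E * \int[mu]_x k (2 * x + 0)%R).
  by rewrite ge0_integral_affine// muleA -EFinM divff// mul1e.
rewrite -ge0_integralZl_EFin//; last by meas.
apply: eq_integral => x _; rewrite addr0 /k ppow_expR mul1r.
rewrite -expRM_natl -muleA [LHS]muleCA -!EFinM; congr (_ * _%:E).
by rewrite -mulrA mulr_natl mulr2n expRD.
Qed.

Lemma ge0_integral_convolution (F G : R -> \bar R) :
  measurable_fun [set: R] F -> measurable_fun [set: R] G ->
  (forall x, 0 <= F x) -> (forall x, 0 <= G x) ->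
  (\int[mu]_x F x) * (\int[mu]_x G x) =
  \int[mu]_w \int[mu]_x (F x * G (w - x)%R).
Proof.
move=> mF mG F0 G0.
rewrite muleC -ge0_integralZl//; last exact: integral_ge0.
transitivity (\int[mu]_x \int[mu]_w (F x * G (w - x)%R)).
  apply: eq_integral => x _; rewrite muleC.
  rewrite -(@ge0_integral_translate _ (- x) G)// ge0_integralZl//.
  by meas.
rewrite (@fubini_tonelli _ _ _ _ _ mu mu (fun z => F z.1 * G (z.2 - z.1)%R))//.
  by meas.
by meas.
Qed.

End real_line_integrals.

(** * Gamma and Beta integrals *)

Section gamma_beta.
Context (R : realType).
Local Notation mu := (@lebesgue_measure R).
Local Open Scope ereal_scope.
Implicit Types a b c w : R.

(** Being extended-real, it satisfies its identities without convergence conditions; finiteness and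
    positivity are then deduced from these identities. *)
Definition egamma a : \bar R := \int[mu]_t (ppow (a - 1) t * expR (- t))%:E.

Definition ebeta a b : \bar R :=
  \int[mu]_x (ppow (a - 1) x * ppow (b - 1) (1 - x))%:E.

Lemma egamma_ge0 a : 0 <= egamma a.
Proof. by rewrite /egamma; meas. Qed.

Lemma ebeta_ge0 a b : 0 <= ebeta a b.
Proof. by rewrite /ebeta; meas. Qed.

(** Homogeneity: scaling x by w extracts w to the power (a - 1) + (b - 1) + 1. If w <= 0, one of the
    two factors vanishes at each x. *)
Lemma integral_ppow_convolution a b w :
  \int[mu]_x (ppow (a - 1) x * ppow (b - 1) (w - x))%:E =
  (ppow (a + b - 1) w)%:E * ebeta a b.
Proof.
have [w0|w0] := ltP 0%R w; last first.
  rewrite ppow_neg// mul0e integral0_eq// => x _.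
  have [x0|x0] := ltP 0%R x; last by rewrite ppow_neg// mul0r.
  by rewrite (@ppow_neg _ _ (w - x)) ?mulr0// subr_le0 (le_trans w0)// ltW.
have H := @ge0_integral_affine R w 0 
  (fun x => (ppow (a - 1) x * ppow (b - 1) (w - x))%:E) w0 _ _.
have w1 : w%:E * w^-1%:E = 1 :> \bar R by rewrite -EFinM divff ?gt_eqF.
rewrite -[LHS]mul1e -[in LHS]w1 -muleA -H; [|by meas..].
under eq_integral => x _.
  rewrite addr0 -{2}(mulr1 w) -mulrBr !ppowZ//.
  rewrite (_ : (_ * _)%R = (w `^ (a - 1) * w `^ (b - 1) *
    (ppow (a - 1) x * ppow (b - 1) (1 - x)))%R); last by ring.
  rewrite EFinM; over.
rewrite ge0_integralZl_EFin//; [|by meas..].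
rewrite muleA -EFinM; congr (_%:E * _).
rewrite -{1}(powRr1 (ltW w0)) -!ppow_pos// !ppowM; congr ppow; ring.
Qed.

(** The product is the integral of a convolution in which the exponentials combine to e^(-w),
    leaving the Beta kernel inside. *)
Lemma egamma_ebeta a b : egamma a * egamma b = ebeta a b * egamma (a + b).
Proof.
rewrite /egamma ge0_integral_convolution; [|by meas..].
transitivity (\int[mu]_w ((expR (- w))%:E *
    ((ppow (a + b - 1) w)%:E * ebeta a b))).
  apply: eq_integral => w _; rewrite -integral_ppow_convolution.
  rewrite -ge0_integralZl_EFin//; [|by meas..].
  apply: eq_integral => x _; rewrite -!EFinM; congr EFin.
  rewrite [RHS]mulrC mulrACA -expRD.
  by congr (_ * expR _)%R; ring.
rewrite muleC -ge0_integralZr//; [|by meas..|exact: ebeta_ge0].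
by apply: eq_integral => w _; rewrite muleA -EFinM mulrC.
Qed.

Lemma egamma1 : egamma 1 = 1.
Proof.
rewrite -(@integral_exponential_pdf R 1 ltr01) /egamma.
apply: (@eq_integral_except _ 0%R) => [||x x0].
- by meas.
- apply/measurable_EFinP; exact: measurable_exponential_pdf.
rewrite /exponential_pdf patchE; case: ifPn; last first.
  rewrite notin_setE/= in_itv/= andbT => /negP.
  by rewrite -ltNge => /ltW ?; rewrite ppow_neg// mul0r.
rewrite inE/= in_itv/= andbT => x1.
rewrite ppow_pos; last by rewrite lt_neqAle eq_sym x0.
by rewrite subrr powRr0 mulN1r.
Qed.

Lemma ebeta1 a : (0 < a)%R -> ebeta a 1 = a^-1%:E.
Proof.
move=> a0; rewrite /ebeta ge0_integral_pos; last 3 first.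
- by meas.
- by meas.
- by move=> x x0; rewrite ppow_neg ?mul0r.
transitivity (\int[mu]_x (if (a * x + 0 <= 0)%R then expR (a * x + 0) else 0)%:E).
  apply: (@eq_integral_except _ 0%R) => [||x x0].
  - by meas.
  - by meas.
  rewrite addr0 -EFinM pmulr_rle0//; congr EFin.
  have [xneg|xpos] := leP x 0%R.
    rewrite (@ppow_pos _ _ (1 - _)%R); last first.
      by rewrite subr_gt0 expR_lt1 lt_neqAle x0.
    rewrite subrr powRr0 mulr1 ppow_expR -expRD; congr expR; ring.
  rewrite (@ppow_neg _ _ (1 - _)%R) ?mulr0 ?mul0r//.
  by rewrite subr_le0 ltW// expR_gt1.
rewrite (@ge0_integral_affine _ _ _ (fun y => (if (y <= 0)%R then expR y else 0)%:E))//;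
  [|by meas..].
by rewrite integral_expRNy expR0 mule1.
Qed.

(** The Beta identity at b = 1, where B(a, 1) = 1/a, takes the place of an integration by parts. *)
Lemma egammaS a : (0 < a)%R -> egamma (a + 1) = a%:E * egamma a.
Proof.
move=> a0; have := egamma_ebeta a 1.
rewrite egamma1 mule1 ebeta1// => ->.
by rewrite muleA -EFinM divff ?gt_eqF// mul1e.
Qed.

Lemma egamma_nat n : egamma n.+1%:R = n`!%:R%:E.
Proof.
elim: n => [|n ih]; first by rewrite egamma1.
by rewrite -natr1 egammaS// ih -EFinM -natrM.
Qed.

(** Pointwise, t^(b - 1) is at most t^(a - 1) for t <= 1 and at most t^(c - 1) for t > 1. *)
Lemma le_egamma a b c : (a <= b <= c)%R -> egamma b <= egamma a + egamma c.
Proof.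
move=> /andP[ab bc]; rewrite /egamma -ge0_integralD//; [|by meas..].
apply: ge0_le_integral => //; [by meas..| |].
  by apply: emeasurable_funD; meas.
move=> t _; rewrite -EFinD lee_fin -mulrDl ler_wpM2r ?expR_ge0//.
rewrite /ppow; case: ifPn => t0; last by rewrite addr0.
have [t1|t1] := leP t 1%R.
  rewrite ler_wpDr ?powR_ge0// /powR gt_eqF// ler_expR.
  by rewrite ler_wnM2r ?ln_le0// lerD2r.
by rewrite ler_wpDl ?powR_ge0// ler_powR ?lerD2r// ltW.
Qed.

(** A small [a] has no positive integer below it, so [a + 1] is compared with integers and the
    functional equation leads back to [a]. *)
Lemma egamma_fin a : (0 < a)%R -> egamma a < +oo.
Proof.
move=> a0; suff : egamma (a + 1) < +oo.
  have a1 : a^-1%:E * a%:E = 1 :> \bar R by rewrite -EFinM mulVf ?gt_eqF.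
  rewrite egammaS// => H; rewrite -[egamma a]mul1e -a1.
  by rewrite -muleA lte_mul_pinfty// lee_fin invr_ge0 ltW.
have := @le_egamma 1%:R (a + 1) (Num.truncn (a + 1)).+2%:R.
rewrite !egamma_nat => H.
apply: le_lt_trans (H _) _; last by rewrite -EFinD ltry.
by rewrite lerDr ltW//= -natr1 ler_wpDr// ltW// truncnS_gt.
Qed.

(* If egamma a = 0 then egamma vanishes at a + 1 as well, hence, by log-convexity
   in the weak form [le_egamma], at the integer in between. *)
Lemma egamma_gt0 a : (0 < a)%R -> 0 < egamma a.
Proof.
move=> a0; rewrite lt_neqAle egamma_ge0 andbT eq_sym; apply/eqP => ga.
have ga1 : egamma (a + 1) = 0 by rewrite egammaS// ga mule0.
have := @le_egamma a (Num.truncn a).+1%:R (a + 1).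
rewrite egamma_nat ga ga1 adde0 lee_fin => H.
suff : (((Num.truncn a)`!%:R : R) <= 0)%R.
  by rewrite lern0 -leqn0 leqNgt fact_gt0.
apply: H; rewrite ltW ?truncnS_gt//= -natr1 lerD2r.
by rewrite truncn_le ltW.
Qed.

(** [Gamma] is the [fine] part of the integral, hence agrees with it only once finiteness is
    known. *)
Lemma egammaE a : (0 < a)%R -> egamma a = (Gamma a)%:E.
Proof.
move=> a0; have ge0 := egamma_ge0 a; have gf := egamma_fin a0.
rewrite -[LHS]fineK ?ge0_fin_numE//; congr EFin; congr fine.
rewrite /egamma [RHS]integral_mkcond; apply: eq_integral => x _.
rewrite patchE; case: ifPn.
  by rewrite inE/= in_itv/= andbT => x0; rewrite ppow_pos.
rewrite notin_setE/= in_itv/= andbT => /negP; rewrite -leNgt => x0.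
by rewrite ppow_neg// mul0r.
Qed.

Lemma Gamma_gt0 a : (0 < a)%R -> (0 < Gamma a)%R.
Proof. by move=> a0; rewrite -lte_fin -egammaE// egamma_gt0. Qed.

Lemma GammaS a : (0 < a)%R -> Gamma (a + 1) = (a * Gamma a)%R.
Proof.
move=> a0; apply: EFin_inj.
by rewrite EFinM -!egammaE ?egammaS ?addr_gt0.
Qed.

(** With t = u^2 the factor t^(-1/2) cancels the Jacobian and the Gaussian integral over the
    half-line remains. *)
Lemma Gamma_half : Gamma (1 / 2 : R) = Num.sqrt pi.
Proof.
apply: EFin_inj; rewrite -egammaE ?divr_gt0// /egamma ge0_integral_sqr; last 3 first.
- by meas.
- by meas.
- by move=> x x0; rewrite ppow_neg// mul0r.
transitivity (2%:E * \int[mu]_(x in `[0%R, +oo[) (gauss_fun x)%:E); last first.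
  by rewrite integral0y_gauss -EFinM mulrC divfK.
rewrite -ge0_integralZl_EFin//; last 2 first.
- by move=> x _; rewrite lee_fin gauss_fun_ge0.
- by apply: measurable_funTS; apply/measurable_EFinP; exact: measurable_gauss_fun.
rewrite [RHS]integral_mkcond.
apply: (@eq_integral_except _ 0%R) => [||x x0].
- by meas.
- apply/(measurable_restrictT _ (measurable_itv _)); apply: measurable_funTS.
  by rewrite /gauss_fun; meas.
rewrite patchE; case: ifPn; last first.
  rewrite notin_setE/= in_itv/= andbT => /negP; rewrite -ltNge => /ltW xneg.
  by rewrite (@ppow_neg _ 1)// mulr0 !mule0.
rewrite inE/= in_itv/= andbT => x1.
have xp : (0 < x)%R by rewrite lt_neqAle eq_sym x0.
rewrite -!EFinM; congr EFin; rewrite /gauss_fun !ppow_pos ?exprn_gt0//.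
rewrite powRr1// -powR_mulrn// -powRrM (_ : 2%:R * (1 / 2 - 1) = -1)%R; last by field.
rewrite powR_inv1 ?ltW//; field; by rewrite gt_eqF.
Qed.

Lemma integral_ppow_expR a c : (0 < a)%R -> (0 < c)%R ->
  \int[mu]_t (ppow (a - 1) t * expR (- (c * t)))%:E = (c `^ (- a) * Gamma a)%:E.
Proof.
move=> a0 c0.
have H := @ge0_integral_affine R c 0 
  (fun t => (ppow (a - 1) t * expR (- t))%:E) c0 _ _.
rewrite EFinM -egammaE//.
have c1 : c%:E * c^-1%:E = 1 :> \bar R by rewrite -EFinM divff ?gt_eqF.
rewrite -[egamma a]mul1e -c1 -(muleA c%:E) -H; [|by meas..].
rewrite muleA -EFinM -ge0_integralZl_EFin//; last 3 first.
- by meas.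
- by meas.
- by rewrite mulr_ge0 ?powR_ge0 ?ltW.
apply: eq_integral => x _; rewrite addr0 -EFinM; congr EFin.
rewrite ppowZ// !mulrA; congr (_ * _)%R; rewrite -[LHS]mul1r; congr (_ * _)%R.
rewrite -{2}(powRr1 (ltW c0)) -!ppow_pos// !ppowM.
by rewrite (_ : (_ + _ + _)%R = 0%R) ?ppow_pos ?powRr0//; ring.
Qed.

End gamma_beta.

(** * Variance-gamma densities *)

Section variance_gamma.
Context (R : realType).
Local Notation mu := (@lebesgue_measure R).
Local Open Scope ereal_scope.
Implicit Types p r q w c : R.

Lemma integral_gauss_scaled c m : (0 < c)%R ->
  \int[mu]_y (expR (- (c * (y - m) ^+ 2)))%:E = (Num.sqrt pi * c `^ (- (1 / 2)))%:E.
Proof.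
move=> c0; pose s : R := (c `^ (1 / 2))%R.
have s0 : (0 < s)%R by rewrite powR_gt0.
have s2 : (s ^+ 2 = c)%R.
  by rewrite -powR_mulrn ?ltW// -powRrM mulrC mulrA mulr1 divff// powRr1// ltW.
transitivity (\int[mu]_y (gauss_fun (s * y + - (s * m))%R)%:E).
  apply: eq_integral => y _; congr (expR (- _))%:E.
  by rewrite -mulrBr exprMn s2.
rewrite (@ge0_integral_affine _ _ _ (fun y => (gauss_fun y)%:E))//; last 2 first.
- by rewrite /gauss_fun; meas.
- by move=> x; rewrite lee_fin gauss_fun_ge0.
by rewrite integralT_gauss -EFinM mulrC powRN.
Qed.

(* [vg] is a Bessel integral, equal to 2 |q|^(p - 1/2) K_(p - 1/2)(2 |q|);
   it is +oo at q = 0 when p <= 1/2, whence the extended-real codomain.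
   [ppow (-1) w] is 1 / w for the relevant w > 0. *)
Definition vg_kernel p w q : R :=
  ppow (p - 3 / 2) w * expR (- w - q ^+ 2 * ppow (-1) w).

Definition vg p q : \bar R := \int[mu]_w (vg_kernel p w q)%:E.

Lemma vg_kernel_ge0 p w q : (0 <= vg_kernel p w q)%R.
Proof. by rewrite /vg_kernel; meas. Qed.

Lemma measurable_vg_kernel d (T : measurableType d) p (f g : T -> R) :
  measurable_fun [set: T] f -> measurable_fun [set: T] g ->
  measurable_fun [set: T] (fun z => vg_kernel p (f z) (g z)).
Proof. by move=> mf mg; rewrite /vg_kernel; meas. Qed.

Lemma vg_ge0 p q : 0 <= vg p q.
Proof. by apply: integral_ge0 => w _; rewrite lee_fin vg_kernel_ge0. Qed.

Lemma vgN p q : vg p (- q)%R = vg p q.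
Proof. by rewrite /vg /vg_kernel sqrrN. Qed.

Lemma measurable_vg p : measurable_fun [set: R] (vg p).
Proof.
apply: (@measurable_fun_fubini_tonelli_F _ _ _ _ R mu
  (fun z => (vg_kernel p z.2 z.1)%:E)).
- by apply/measurable_EFinP; exact: measurable_vg_kernel.
- by move=> z; rewrite lee_fin vg_kernel_ge0.
Qed.

(** The exponent p - 3/2 is (p - 1) - 1/2: a Gamma weight in w, times the normalisation w^(-1/2) of
    the Gaussian e^(-q^2/w) of variance w/2. Convolution adds variances, so a Gaussian normalised by
    (a + b)^(-1/2) reappears as [vg_kernel 1 (a + b)], and the powers of the Gamma weights stay
    outside. *)
Lemma vg_kernel_convolution p r (a b q : R) :
  \int[mu]_y (vg_kernel p a y * vg_kernel r b (q - y))%:E =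
  (ppow (p - 1) a * ppow (r - 1) b *
   (Num.sqrt pi * vg_kernel 1 (a + b) q))%:E.
Proof.
have [a0|a0] := ltP 0%R a; last first.
  rewrite (@ppow_neg _ _ a)// !mul0r integral0_eq// => y _.
  by rewrite /vg_kernel ppow_neg// !mul0r.
have [b0|b0] := ltP 0%R b; last first.
  rewrite (@ppow_neg _ _ b)// mulr0 mul0r integral0_eq// => y _.
  by rewrite /vg_kernel (@ppow_neg _ _ b)// !mul0r mulr0.
have ab0 : (0 < a + b)%R by rewrite addr_gt0.
(* y^2 / a + (q - y)^2 / b = c (y - q a / (a + b))^2 + q^2 / (a + b) *)
pose c : R := ((a + b) / (a * b))%R.
have c0 : (0 < c)%R by rewrite divr_gt0// mulr_gt0.
transitivity (\int[mu]_y ((ppow (p - 3 / 2) a * ppow (r - 3 / 2) b *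
   expR (- (a + b) - q ^+ 2 / (a + b)))%:E *
  (expR (- (c * (y - q * a / (a + b)) ^+ 2)))%:E)).
  apply: eq_integral => y _; rewrite /vg_kernel -EFinM; congr EFin.
  rewrite mulrACA -[RHS]mulrA -!expRD; congr (_ * expR _)%R.
  rewrite !ppow_pos// !powR_inv1 ?ltW// /c; field.
  by rewrite !gt_eqF.
rewrite ge0_integralZl_EFin//; [|by meas..].
rewrite integral_gauss_scaled// -EFinM; congr EFin.
rewrite /vg_kernel.
have -> : (c `^ (- (1 / 2)))%R =
    (ppow (1 / 2) a * ppow (1 / 2) b * ppow (1 - 3 / 2) (a + b))%R.
  have ab1 : (0 < a * b)%R by rewrite mulr_gt0.
  rewrite (_ : a + b = c * (a * b))%R; last by rewrite /c divfK ?gt_eqF.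
  rewrite !(ppow_pos _ a0, ppow_pos _ b0, ppow_pos _ (mulr_gt0 c0 ab1)).
  rewrite -powRM ?ltW// (@powRM _ c (a * b)%R) ?ltW//.
  rewrite mulrCA -powRD ?(gt_eqF ab1) ?implybT//.
  rewrite (_ : 1 / 2 + _ = 0)%R ?powRr0 ?mulr1; last by field.
  by congr (_ `^ _)%R; field.
rewrite (@ppow_pos _ (-1) _ ab0) powR_inv1 ?ltW//.
rewrite -(_ : (p - 3 / 2) + 1 / 2 = p - 1)%R; last by field.
rewrite -(_ : (r - 3 / 2) + 1 / 2 = r - 1)%R; last by field.
rewrite -!ppowM; ring.
Qed.

(** Tonelli brings y innermost, where the Gaussians convolve. With w = a + b the integral over a is
    then the convolution of two powers, that is, a sum of Gamma variables of shapes p and r has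
    shape p + r. *)
Lemma vg_convolution p r q :
  \int[mu]_y (vg p y * vg r (q - y)%R) =
  (Num.sqrt pi)%:E * ebeta p r * vg (p + r) q.
Proof.
have k0 := vg_kernel_ge0.
transitivity (\int[mu]_a \int[mu]_y ((vg_kernel p a y)%:E * vg r (q - y)%R)).
  rewrite -(@fubini_tonelli _ _ _ _ _ mu mu
    (fun z => (vg_kernel p z.2 z.1)%:E * vg r (q - z.1)%R))//.
  - apply: eq_integral => y _; rewrite /= ge0_integralZr//.
    + by apply/measurable_EFinP; exact: measurable_vg_kernel.
    + by move=> a _; rewrite lee_fin k0.
    + exact: vg_ge0.
  - apply: emeasurable_funM.
      by apply/measurable_EFinP; exact: measurable_vg_kernel.
    by apply: (measurableT_comp (measurable_vg _)); meas.
  - by move=> z; rewrite mule_ge0 ?vg_ge0// lee_fin.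
transitivity (\int[mu]_a \int[mu]_b
  (ppow (p - 1) a * ppow (r - 1) b * (Num.sqrt pi * vg_kernel 1 (a + b) q))%:E).
  apply: eq_integral => a _.
  under eq_integral => y _.
    rewrite /vg -ge0_integralZl//; last 3 first.
    - by apply/measurable_EFinP; exact: measurable_vg_kernel.
    - by move=> b _; rewrite lee_fin.
    - by rewrite lee_fin.
    over.
  rewrite (@fubini_tonelli _ _ _ _ _ mu mu
    (fun z => (vg_kernel p a z.1)%:E * (vg_kernel r z.2 (q - z.1))%:E))//; last 2 first.
  - apply: emeasurable_funM; apply/measurable_EFinP; apply: measurable_vg_kernel => //.
    by meas.
  - by move=> z; rewrite mule_ge0// lee_fin.
  apply: eq_integral => b _; rewrite -vg_kernel_convolution.
  by apply: eq_integral => y _; rewrite EFinM.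
have mvg1 : measurable_fun [set: R] (fun w => vg_kernel 1 w q).
  exact: measurable_vg_kernel.
transitivity (\int[mu]_a \int[mu]_w
  ((ppow (p - 1) a * ppow (r - 1) (w - a))%:E *
   (Num.sqrt pi * vg_kernel 1 w q)%:E)).
  apply: eq_integral => a _.
  rewrite -(@ge0_integral_translate _ (- a)%R); last 2 first.
  - apply/measurable_EFinP; apply: measurable_funM; first by meas.
    apply: measurable_funM => //; apply: measurable_vg_kernel => //.
    exact: measurable_funD.
  - by move=> b; rewrite lee_fin !mulr_ge0// ?ppow_ge0.
  by apply: eq_integral => w _; rewrite -EFinM (addrC a) subrK.
rewrite (@fubini_tonelli _ _ _ _ _ mu mu (fun z =>
  ((ppow (p - 1) z.1 * ppow (r - 1) (z.2 - z.1))%:E *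
   (Num.sqrt pi * vg_kernel 1 z.2 q)%:E)))//; last 2 first.
- apply: emeasurable_funM; first by meas.
  apply/measurable_EFinP; apply: measurable_funM => //.
  exact: (measurableT_comp mvg1).
- by move=> z; rewrite mule_ge0// lee_fin !mulr_ge0// ?ppow_ge0.
have mk : measurable_fun [set: R] (fun w => (vg_kernel (p + r) w q)%:E).
  by apply/measurable_EFinP; exact: measurable_vg_kernel.
transitivity (\int[mu]_w ((Num.sqrt pi)%:E * (vg_kernel (p + r) w q)%:E *
    ebeta p r)); last first.
  rewrite ge0_integralZr//; last 3 first.
  - exact: measurable_funeM.
  - by move=> w _; rewrite mule_ge0// lee_fin.
  - exact: ebeta_ge0.
  rewrite ge0_integralZl_EFin//; last by move=> w _; rewrite lee_fin.
  exact: muleAC.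
apply: eq_integral => w _ /=.
rewrite ge0_integralZr//; last 3 first.
- by meas.
- by meas.
- by rewrite lee_fin mulr_ge0.
rewrite integral_ppow_convolution muleAC -!EFinM; congr (_%:E * _).
rewrite mulrCA; congr (_ * _)%R; rewrite /vg_kernel mulrA ppowM.
by congr (ppow _ _ * _)%R; ring.
Qed.

End variance_gamma.

(** * Normalised densities and their convolution semigroup *)

Section variance_gamma_density.
Context (R : realType).
Local Notation mu := (@lebesgue_measure R).
Local Open Scope ereal_scope.
Implicit Types p r q w c rho : R.

(** [ppow 0] is the indicator of the open positive half-line; the point 0 is negligible. *)
Lemma ge0_integral_symmetrize (h : R -> \bar R) : measurable_fun [set: R] h ->
  (forall x, 0 <= h x) ->
  \int[mu]_x h x = \int[mu]_x ((ppow 0 x)%:E * (h x + h (- x)%R)).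
Proof.
move=> mh h0.
under [RHS]eq_integral => x _ do rewrite ge0_muleDr//.
rewrite ge0_integralD//; [|by meas..].
rewrite -[X in _ + X]ge0_integral_opp; [|by meas..].
rewrite -ge0_integralD//; [|by meas..].
apply: (@eq_integral_except _ 0%R) => // [|x x0].
  by apply: emeasurable_funD; meas.
rewrite opprK /ppow; have [x1|x1|x1] := ltgtP 0%R x.
- by rewrite oppr_gt0 ltNge (ltW x1)/= powRr0 mul0e mul1e adde0.
- by rewrite oppr_gt0 x1 powRr0 mul0e mul1e add0e.
- by rewrite x1 eqxx in x0.
Qed.

Definition vg_pdf rho p q : \bar R :=
  (((1 - rho ^+ 2) `^ p / (Num.sqrt pi * Gamma p) * expR (2 * rho * q))%R)%:E
  * vg p q.

Lemma one_sub_sqr_gt0 rho : (-1 < rho)%R -> (rho < 1)%R -> (0 < 1 - rho ^+ 2)%R.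
Proof. by move=> ? ?; nra. Qed.

Lemma vg_pdf_coef_ge0 rho p q : (0 < p)%R ->
  (0 <= (1 - rho ^+ 2) `^ p / (Num.sqrt pi * Gamma p) * expR (2 * rho * q))%R.
Proof.
move=> p0; rewrite !mulr_ge0 ?powR_ge0 ?expR_ge0// invr_ge0 mulr_ge0 ?sqrtr_ge0//.
by rewrite ltW// Gamma_gt0.
Qed.

Lemma vg_pdf_ge0 rho p q : (0 < p)%R -> 0 <= vg_pdf rho p q.
Proof.
move=> p0; rewrite mule_ge0 ?vg_ge0// lee_fin; exact: vg_pdf_coef_ge0.
Qed.

Lemma measurable_vg_pdf rho p : measurable_fun [set: R] (vg_pdf rho p).
Proof.
by apply: emeasurable_funM; [meas|exact: measurable_vg].
Qed.

Lemma ebetaE p r : (0 < p)%R -> (0 < r)%R ->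
  ebeta p r = (Gamma p * Gamma r / Gamma (p + r))%:E.
Proof.
move=> p0 r0; have pr0 := addr_gt0 p0 r0.
have := egamma_ebeta p r; rewrite !egammaE// -EFinM EFinM => H.
rewrite !EFinM H -muleA -EFinM divff ?mule1// gt_eqF//; exact: Gamma_gt0.
Qed.

Lemma vg_pdf_convolution rho p r q : (-1 < rho)%R -> (rho < 1)%R ->
  (0 < p)%R -> (0 < r)%R ->
  \int[mu]_y (vg_pdf rho p y * vg_pdf rho r (q - y)%R) = vg_pdf rho (p + r) q.
Proof.
move=> rhoN1 rho1 p0 r0.
have rho2 := one_sub_sqr_gt0 rhoN1 rho1.
pose K s : R := ((1 - rho ^+ 2) `^ s / (Num.sqrt pi * Gamma s))%R.
have K0 s : (0 < s)%R -> (0 <= K s)%R.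
  move=> s0; rewrite mulr_ge0 ?powR_ge0// invr_ge0 mulr_ge0 ?sqrtr_ge0//.
  by rewrite ltW// Gamma_gt0.
transitivity (\int[mu]_y ((K p * K r * expR (2 * rho * q))%:E *
    (vg p y * vg r (q - y)%R))).
  apply: eq_integral => y _; rewrite /vg_pdf muleACA -EFinM.
  congr (_%:E * _); rewrite -/(K p) -/(K r) mulrACA -expRD.
  by congr (_ * expR _)%R; ring.
rewrite ge0_integralZl_EFin//; last 3 first.
- by move=> y _; rewrite mule_ge0 ?vg_ge0.
- apply: emeasurable_funM; first exact: measurable_vg.
  by apply: (measurableT_comp (measurable_vg _)); meas.
- by apply: mulr_ge0; [apply: mulr_ge0; exact: K0|exact: expR_ge0].
(* What remains is the identity K(p) K(r) sqrt(pi) B(p, r) = K(p + r). *)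
rewrite vg_convolution ebetaE// muleA -!EFinM /vg_pdf; congr (_%:E * _).
rewrite mulrAC; congr (_ * _)%R.
have pr0 := addr_gt0 p0 r0.
rewrite /K powRD; last by rewrite (gt_eqF rho2) implybT.
have : (0 < Num.sqrt (pi : R))%R by rewrite sqrtr_gt0 pi_gt0.
move: (Gamma_gt0 p0) (Gamma_gt0 r0) (Gamma_gt0 pr0).
move: (Num.sqrt pi) (Gamma p) (Gamma r) (Gamma _) => c x y z x0 y0 z0 c0.
by field; rewrite !gt_eqF.
Qed.

End variance_gamma_density.

(** * The law of the product *)

Section product_law.
Context (R : realType).
Local Notation mu := (@lebesgue_measure R).
Local Open Scope ereal_scope.

(** For p = 1/2 the weight dw/w becomes 2 du/u under w = u^2, so u can be matched with the first
    factor of the product. *)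
Lemma vg_half q : vg (1 / 2) q =
  \int[mu]_u (2 * ppow (-1) u * expR (- u ^+ 2 - q ^+ 2 * ppow (-1) u ^+ 2))%:E.
Proof.
rewrite /vg /vg_kernel ge0_integral_sqr; last 3 first.
- by meas.
- by meas.
- by move=> x x0; rewrite ppow_neg// mul0r.
apply: eq_integral => u _; rewrite -EFinM; congr EFin.
have [u0|u0] := ltP 0%R u; last by rewrite !(ppow_neg _ u0) !(mulr0, mul0r).
rewrite !(ppow_pos _ u0) !ppow_pos ?exprn_gt0//.
rewrite (_ : 1 / 2 - 3 / 2 = -1)%R; last by field.
rewrite !powR_inv1 ?exprn_ge0 ?ltW// powRr1 ?ltW// exprVn mulrAC.
by congr (_ * _)%R; field; rewrite gt_eqF.
Qed.

Lemma ppowN1_scale (c : R) (h : R -> \bar R) : (0 < c)%R ->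
  measurable_fun [set: R] h -> (forall x, 0 <= h x) ->
  \int[mu]_u ((ppow (-1) u)%:E * h (c * u)%R) =
  \int[mu]_u ((ppow (-1) u)%:E * h u).
Proof.
move=> c0 mh h0.
have c1 : c%:E * c^-1%:E = 1 :> \bar R by rewrite -EFinM divff ?gt_eqF.
have H := @ge0_integral_affine R c 0 (fun u => (ppow (-1) u)%:E * h u) c0 _ _.
rewrite -[RHS]mul1e -c1 -muleA -H; [|by meas..].
rewrite -ge0_integralZl_EFin//; last 3 first.
- by move=> x _; meas.
- by meas.
- exact: ltW.
apply: eq_integral => u _; rewrite addr0 muleA -EFinM; congr (_%:E * _).
by rewrite ppowZ// powR_inv1 ?ltW// mulrA divff ?mul1r// gt_eqF.
Qed.

Variables (s1 s2 rho : R).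
Hypotheses (s1_gt0 : (0 < s1)%R) (s2_gt0 : (0 < s2)%R).
Hypotheses (rho_gtN1 : (-1 < rho)%R) (rho_lt1 : (rho < 1)%R).

Let tau : R := (2 * (s1 * s2) * (1 - rho ^+ 2))%R.
Let rho2 : (0 < 1 - rho ^+ 2)%R := one_sub_sqr_gt0 rho_gtN1 rho_lt1.
Let tau_gt0 : (0 < tau)%R. Proof. by rewrite !mulr_gt0. Qed.

Let pdf (u v : R) := bivariate_normal_pdf 0 0 s1 s2 rho (u, v).

Let pdf_ge0 u v : (0 <= pdf u v)%R.
Proof.
rewrite /pdf /bivariate_normal_pdf mulr_ge0 ?expR_ge0// invr_ge0.
by rewrite !mulr_ge0 ?sqrtr_ge0 ?pi_ge0 ?ltW.
Qed.

Let pdfN u v : pdf (- u)%R (- v)%R = pdf u v.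
Proof.
by rewrite /pdf /bivariate_normal_pdf/= !subr0 !mulNr !sqrrN !mulrN !mulNr !opprK.
Qed.

Let measurable_pdf d (T : measurableType d) (f g : T -> R) :
  measurable_fun [set: T] f -> measurable_fun [set: T] g ->
  measurable_fun [set: T] (fun z => pdf (f z) (g z)).
Proof.
move=> mf mg; rewrite /pdf /bivariate_normal_pdf/=.
by meas.
Qed.

(** For fixed u > 0 the substitution v = tau q / u has Jacobian tau / u. The factor 2 accounts for
    both signs of u. *)
Lemma product_density q :
  \int[mu]_u ((ppow (-1) u)%:E * (2 * tau * pdf u (tau * q * ppow (-1) u))%:E) =
  vg_pdf rho (1 / 2) q.
Proof.
(* The measure du / u is scale invariant; this scale turns u^2 into w. *)
pose k : R := (s1 * Num.sqrt (2 * (1 - rho ^+ 2)))%R.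
have k0 : (0 < k)%R by rewrite mulr_gt0// sqrtr_gt0 mulr_gt0.
have k2 : (k ^+ 2 = s1 ^+ 2 * (2 * (1 - rho ^+ 2)))%R.
  by rewrite exprMn sqr_sqrtr// mulr_ge0// ltW.
rewrite -(ppowN1_scale k0); last 2 first.
- apply/measurable_EFinP/measurable_funM => //.
  by apply: measurable_pdf => //; meas.
- by move=> x; rewrite lee_fin mulr_ge0 ?pdf_ge0// mulr_ge0// ltW.
pose C : R := ((1 - rho ^+ 2) `^ (1 / 2) / (Num.sqrt pi * Gamma (1 / 2)) *
  expR (2 * rho * q))%R.
transitivity (\int[mu]_u (C%:E * (2 * ppow (-1) u *
    expR (- u ^+ 2 - q ^+ 2 * ppow (-1) u ^+ 2))%:E)); last first.
  rewrite ge0_integralZl_EFin//; last 3 first.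
  - by meas.
  - by meas.
  - exact: vg_pdf_coef_ge0.
  by rewrite -vg_half.
apply: eq_integral => u _; rewrite -!EFinM; congr EFin.
have [u0|u0] := ltP 0%R u; last by rewrite !(ppow_neg _ u0) !(mulr0, mul0r).
rewrite ppowZ// !(ppow_pos _ u0) !powR_inv1 ?ltW//.
rewrite /C Gamma_half -expr2 sqr_sqrtr ?pi_ge0//.
(* Both standardised coordinates are multiples of r, and r^2 cancels the denominator of the
   exponent. *)
pose r : R := Num.sqrt (2 * (1 - rho ^+ 2))%R.
have r0 : (0 < r)%R by rewrite sqrtr_gt0 mulr_gt0.
have r2 : (2 * (1 - rho ^+ 2) = r ^+ 2)%R.
  by rewrite sqr_sqrtr// mulr_ge0// ltW.
pose t : R := Num.sqrt (1 - rho ^+ 2)%R.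
have t0 : (0 < t)%R by rewrite sqrtr_gt0.
have t2 : (1 - rho ^+ 2 = t ^+ 2)%R by rewrite sqr_sqrtr// ltW.
have hx : ((k * u - 0) / s1 = r * u)%R.
  by rewrite /k -/r; field; rewrite gt_eqF.
have hy : ((tau * q * (k^-1 / u) - 0) / s2 = r * (q / u))%R.
  rewrite /k -/r (_ : tau = s1 * s2 * r ^+ 2)%R; last by rewrite -r2 /tau; ring.
  by field; rewrite !gt_eqF.
rewrite /pdf /bivariate_normal_pdf /fst /snd hx hy.
have -> : (- ((r * u) ^+ 2 - 2 * rho * (r * u) * (r * (q / u)) + (r * (q / u)) ^+ 2) /
    (2 * (1 - rho ^+ 2)) = 2 * rho * q + (- u ^+ 2 - q ^+ 2 * u^-1 ^+ 2))%R.
  by rewrite r2; field; rewrite !gt_eqF.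
rewrite expRD div1r powR12_sqrt; last exact: ltW.
rewrite /tau -/t t2; move: (expR _) (expR _) (pi_gt0 R) => e1 e2.
move: (pi : R) => c c0; field.
by rewrite !gt_eqF.
Qed.

Lemma bivariate_normal_product_law d (T : measurableType d) (P : probability T R)
    (U V : T -> R) :
  is_bivariate_normal P U V 0 0 s1 s2 rho ->
  forall B : set R, measurable B ->
    P ((fun w => U w * V w / tau)%R @^-1` B) =
    \int[mu]_(q in B) vg_pdf rho (1 / 2) q.
Proof.
move=> UVn B mB.
have mI : measurable_fun [set: R] (\1_B : R -> R) by exact: measurable_indic.
have I0 x : (0 <= \1_B x :> R)%R by [].
pose f (z : R * R) : R := (z.1 * z.2 / tau)%R.
have mf : measurable_fun [set: R * R] f.
  by apply: measurable_funM => //; apply: measurable_funM.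
rewrite (_ : _ @^-1` B = (fun w => (U w, V w)) @^-1` (f @^-1` B))//.
rewrite UVn; last by rewrite -[X in measurable X]setTI; exact: mf.
rewrite integral_mkcond.
under eq_integral => z _.
  rewrite (_ : _ z = ((\1_B (f z))%R * pdf z.1 z.2)%:E); last first.
    rewrite patchE indicE /pdf -surjective_pairing.
    have -> : (z \in f @^-1` B) = (f z \in B).
      by apply/idP/idP => /set_mem ?; exact/mem_set.
    by case: ifP => _; rewrite ?mul1r ?mul0r.
  over.
rewrite fubini_tonelli1; last 2 first.
- apply/measurable_EFinP/measurable_funM; last exact: measurable_pdf.
  exact: measurableT_comp.
- by move=> z; rewrite lee_fin mulr_ge0.
rewrite /fubini_F/=.
pose W u q := (ppow (-1) u)%:E * (2 * tau * pdf u (tau * q * ppow (-1) u))%:E.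
have W0 u q : 0 <= W u q.
  apply: mule_ge0; rewrite lee_fin; first exact: ppow_ge0.
  by apply: mulr_ge0 => //; rewrite mulr_ge0// ltW.
have mW d' (T' : measurableType d') (a b : T' -> R) :
    measurable_fun [set: T'] a -> measurable_fun [set: T'] b ->
    measurable_fun [set: T'] (fun z => W (a z) (b z)).
  move=> ma mb; apply: emeasurable_funM; first by meas.
  apply/measurable_EFinP/measurable_funM => //.
  by apply: measurable_pdf => //; meas.
pose h u := \int[mu]_v ((\1_B (f (u, v)))%R * pdf u v)%:E.
have mh : measurable_fun [set: R] h.
  apply: (@measurable_fun_fubini_tonelli_F _ _ _ _ R mu
    (fun z => ((\1_B (f z))%R * pdf z.1 z.2)%:E)).
  - apply/measurable_EFinP/measurable_funM; last exact: measurable_pdf.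
    exact: measurableT_comp.
  - by move=> z; rewrite lee_fin mulr_ge0.
(* The density and the product are both invariant under (u, v) -> (-u, -v). *)
have hN u : h (- u)%R = h u.
  rewrite /h -[LHS]ge0_integral_opp; last 2 first.
  - apply/measurable_EFinP/measurable_funM; last exact: measurable_pdf.
    by apply: (measurableT_comp mI); apply: (measurableT_comp mf);
      exact: measurable_fun_pair.
  - by move=> v; rewrite lee_fin mulr_ge0.
  by apply: eq_integral => v _; rewrite pdfN /f/= mulrNN.
rewrite -/h.
transitivity (\int[mu]_u h u) => //.
rewrite ge0_integral_symmetrize//; last first.
  by move=> u; apply: integral_ge0 => v _; rewrite lee_fin mulr_ge0.
transitivity (\int[mu]_u \int[mu]_q ((\1_B q)%:E *
   ((ppow (-1) u)%:E * (2 * tau * pdf u (tau * q * ppow (-1) u))%:E))).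
  apply: eq_integral => u _.
  have [u0|u0] := ltP 0%R u; last first.
    rewrite ppow_neg// mul0e integral0_eq// => q _.
    by rewrite ppow_neg// mul0e mule0.
  rewrite hN /h ppow_pos// powRr0 mul1e.
  (* Chosen so that v = c q gives [f (u, v)] = q. *)
  pose c := (tau / u)%R; have c0 : (0 < c)%R by rewrite divr_gt0.
  have H := @ge0_integral_affine R c 0
    (fun v => ((\1_B (f (u, v)))%R * pdf u v)%:E) c0 _ _.
  have c1 : c%:E * c^-1%:E = 1 :> \bar R by rewrite -EFinM divff ?gt_eqF.
  rewrite -[X in X + _]mul1e -[X in _ + X]mul1e -c1 -muleA -H; last 2 first.
  - apply/measurable_EFinP/measurable_funM; last exact: measurable_pdf.
    by apply: (measurableT_comp mI); apply: (measurableT_comp mf);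
      exact: measurable_fun_pair.
  - by move=> v; rewrite lee_fin mulr_ge0.
  rewrite -ge0_muleDl ?lee_fin ?(ltW c0)// -EFinD.
  have fE q : f (u, c * q + 0)%R = q.
    by rewrite /f /c /=; field; rewrite !gt_eqF.
  under eq_integral => q _ do rewrite fE.
  rewrite -ge0_integralZl_EFin//; last 3 first.
  - by move=> q _; rewrite lee_fin mulr_ge0.
  - apply/measurable_EFinP/measurable_funM => //; apply: measurable_pdf => //.
    by meas.
  - by rewrite addr_ge0// ltW.
  apply: eq_integral => q _; rewrite ppow_pos// powR_inv1 ?(ltW u0)// -!EFinM.
  rewrite addr0 (_ : c * q = tau * q * u^-1)%R; last by rewrite /c mulrAC.
  by congr EFin; rewrite /c; ring.
rewrite (@fubini_tonelli _ _ _ _ _ mu mu (fun z => (\1_B z.2)%:E *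
   ((ppow (-1) z.1)%:E * (2 * tau * pdf z.1 (tau * z.2 * ppow (-1) z.1))%:E)))//;
  last 2 first.
- apply: emeasurable_funM; last exact: mW.
  by apply/measurable_EFinP; exact: measurableT_comp.
- by move=> z; rewrite mule_ge0// ?W0// lee_fin.
rewrite [RHS]integral_mkcond; apply: eq_integral => q _ /=.
rewrite ge0_integralZl//; last 2 first.
- exact: mW.
- by move=> u _; exact: W0.
rewrite product_density patchE indicE.
by case: ifP => _; rewrite ?mul1e ?mul0e.
Qed.

End product_law.

(** * Sums of independent variables *)

Section independent_sums.
Context (R : realType).
Local Notation mu := (@lebesgue_measure R).
Local Open Scope ereal_scope.

(** The factorisation on rectangles, a generating pi-system, identifies the joint law as f(x) g(y)
    dx dy. A finite measure is allowed, rather than a probability, because it will be applied to a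
    restriction of [P] to an event. *)
Lemma sum_density d (T : measurableType d) (m : {measure set T -> \bar R})
    (X Y : T -> R) (f g : R -> \bar R) :
  m [set: T] < +oo ->
  measurable_fun [set: T] X -> measurable_fun [set: T] Y ->
  measurable_fun [set: R] f -> (forall x, 0 <= f x) ->
  measurable_fun [set: R] g -> (forall x, 0 <= g x) ->
  (forall A B : set R, measurable A -> measurable B ->
    m (X @^-1` A `&` Y @^-1` B) =
    (\int[mu]_(x in A) f x) * (\int[mu]_(x in B) g x)) ->
  forall A : set R, measurable A ->
  m ((fun w => X w + Y w)%R @^-1` A) =
  \int[mu]_(z in A) \int[mu]_x (f x * g (z - x)%R).
Proof.
move=> mfin mX mY mf f0 mg g0 XY A mA.
pose RR := (measurableTypeR R * measurableTypeR R)%type.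
have mXY : measurable_fun [set: T] ((fun w => (X w, Y w)) : T -> RR).
  exact: measurable_fun_pair.
have [m' [m'E _]] := pushforward_measure_exists m mXY.
pose F (z : R * R) := f z.1 * g z.2.
have mF : measurable_fun [set: R * R] F.
  by apply: emeasurable_funM; apply: measurableT_comp.
have F0 z : 0 <= F z by rewrite mule_ge0.
pose M : {measure set RR -> \bar R} := density_measure (mu \x mu)%E mF F0.
have m'M C : measurable C -> m' C = M C.
  pose G : set (set RR) :=
    [set C | exists A, measurable A /\ exists B, measurable B /\ C = A `*` B].
  apply: (measure_unique G (fun=> setT)).
  - rewrite measurable_prod_measurableType; congr (<<s _ >>).
    rewrite predeqE; split => [[B mB [D mD <-]]|[B [mB [D [mD ->]]]]].
      by exists B; split => //; exists D.
    by exists B => //; exists D.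
  - move=> /= _ _ [X1 [mX1 [X2 [mX2 ->]]]] [Y1 [mY1 [Y2 [mY2 ->]]]].
    rewrite -setXI; exists (X1 `&` Y1); split; first exact: measurableI.
    by exists (X2 `&` Y2); split => //; exact: measurableI.
  - by move=> _; exists setT; split => //; exists setT; rewrite setXTT.
  - by rewrite bigcup_const//; exists 0%N.
  - move=> _ [B [mB [D [mD ->]]]].
    rewrite m'E [LHS](XY B D mB mD).
    transitivity (\int[mu \x mu]_(z in B `*` D) F z) => //.
    rewrite [RHS]integral_mkcond.
    under [RHS]eq_integral => z _.
      rewrite (_ : _ z = (f \_ B) z.1 * (g \_ D) z.2); last first.
        case: z => x y; rewrite !patchE/=.
        case: (ifPn (x \in B)) => [xB|/negP xB]; last first.
          (* Outside its set a restricted function takes the default value [point], which is 0 in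
             [\bar R]. *)
          rewrite -[point]/(0 : \bar R) mul0e ifF//.
          by apply/negP => /set_mem[/= /mem_set].
        case: (ifPn (y \in D)) => [yD|/negP yD]; last first.
          rewrite -[point]/(0 : \bar R) mule0 ifF//.
          by apply/negP => /set_mem[/= _ /mem_set].
        by rewrite ifT//; apply/mem_set; split; exact/set_mem.
      over.
    have mfB : measurable_fun [set: R] (f \_ B).
      by apply/(measurable_restrictT _ mB); exact: measurable_funTS.
    have mgD : measurable_fun [set: R] (g \_ D).
      by apply/(measurable_restrictT _ mD); exact: measurable_funTS.
    have fB0 x : 0 <= (f \_ B) x by exact: erestrict_ge0.
    have gD0 x : 0 <= (g \_ D) x by exact: erestrict_ge0.
    rewrite fubini_tonelli1; last 2 first.
    - by apply: emeasurable_funM; apply: measurableT_comp.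
    - by move=> z; rewrite mule_ge0.
    rewrite /fubini_F/=.
    under [RHS]eq_integral => x _ do rewrite ge0_integralZl//.
    rewrite ge0_integralZr//; last exact: integral_ge0.
    by rewrite -!integral_mkcond.
  - by move=> _; rewrite m'E.
have mI : measurable_fun [set: R] (\1_A : R -> R) by exact: measurable_indic.
have madd : measurable_fun [set: R * R] (fun z => z.1 + z.2)%R.
  exact: measurable_funD.
transitivity (m' ((fun z => z.1 + z.2)%R @^-1` A)); first by rewrite m'E.
rewrite m'M; last by rewrite -[X in measurable X]setTI; exact: madd.
transitivity (\int[mu \x mu]_z ((\1_A (z.1 + z.2)%R)%:E * F z)).
  rewrite -[LHS]/(\int[mu \x mu]_(z in _) F z) integral_mkcond.
  apply: eq_integral => z _; rewrite patchE indicE.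
  have -> : (z \in (fun z => z.1 + z.2)%R @^-1` A) = ((z.1 + z.2)%R \in A).
    by apply/idP/idP => /set_mem ?; exact/mem_set.
  by case: ifP => _; rewrite ?mul1e ?mul0e.
rewrite fubini_tonelli1; last 2 first.
- apply: emeasurable_funM => //; apply/measurable_EFinP.
  exact: (measurableT_comp mI).
- by move=> z; rewrite mule_ge0 ?mule_ge0 ?lee_fin.
rewrite /fubini_F/=.
transitivity (\int[mu]_x \int[mu]_z ((\1_A z)%:E * (f x * g (z - x)%R))).
  apply: eq_integral => x _.
  rewrite -(@ge0_integral_translate _ (- x)%R
    (fun y => (\1_A (x + y)%R)%:E * (f x * g y))); last 2 first.
  - apply: emeasurable_funM.
      apply/measurable_EFinP; apply: (measurableT_comp mI).
      exact: measurable_funD.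
    by meas.
  - by move=> y; rewrite mule_ge0 ?mule_ge0 ?lee_fin.
  by apply: eq_integral => y _; rewrite (addrC x) subrK.
rewrite (@fubini_tonelli _ _ _ _ _ mu mu
  (fun z => (\1_A z.2)%:E * (f z.1 * g (z.2 - z.1)%R)))/=; last 2 first.
- apply: emeasurable_funM; last by meas.
  by apply/measurable_EFinP; exact: measurableT_comp.
- by move=> z; rewrite !mule_ge0 ?lee_fin.
rewrite [RHS]integral_mkcond; apply: eq_integral => z _ /=.
rewrite ge0_integralZl//; last 2 first.
- by meas.
- by move=> x _; rewrite mule_ge0.
by rewrite patchE indicE; case: ifP => _; rewrite ?mul1e ?mul0e.
Qed.

End independent_sums.

Section independent_sums.
Context (R : realType).
Local Notation mu := (@lebesgue_measure R).
Local Open Scope ereal_scope.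

(** Indices are shifted by one: [f j] is the density of a sum of j + 1 terms. *)
Lemma independent_sum_density d (T : measurableType d) (P : probability T R)
    (n : nat) (X : 'I_n.+1 -> T -> R) (f : nat -> R -> \bar R) :
  (forall i, measurable_fun [set: T] (X i)) ->
  mutually_independent P X ->
  (forall j, measurable_fun [set: R] (f j)) -> (forall j x, 0 <= f j x) ->
  (forall i (B : set R), measurable B ->
    P (X i @^-1` B) = \int[mu]_(x in B) f 0%N x) ->
  (forall j x, \int[mu]_y (f j y * f 0%N (x - y)%R) = f j.+1 x) ->
  forall A : set R, measurable A ->
    P ((fun w => \sum_(i < n.+1) X i w)%R @^-1` A) = \int[mu]_(x in A) f n x.
Proof.
move=> mX indep mf f0 law conv.
pose S j w : R := (\sum_(i < n.+1 | (i <= j)%N) X i w)%R.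
pose F j (B : 'I_n.+1 -> set R) : set T :=
  [set w | forall i : 'I_n.+1, (j < i)%N -> B i (X i w)].
have mS j : measurable_fun [set: T] (S j).
  rewrite /S; under eq_fun do rewrite big_mkcond/=.
  apply: measurable_sum => i; case: (leqP i j) => _; [exact: mX|exact: measurable_cst].
have mF j B : (forall i, measurable (B i)) -> measurable (F j B).
  move=> mB.
  rewrite (_ : F j B = \bigcap_(i in [set i : 'I_n.+1 | (j < i)%N]) (X i @^-1` B i)).
    apply: fin_bigcap_measurable => // i _.
    by rewrite -[X in measurable X]setTI; exact: mX.
  by apply/seteqP; split => w /= H i; exact: H.
have PX i (B : set R) : measurable B -> P (X i @^-1` B) \is a fin_num.
  move=> mB; apply: fin_num_measure.
  by rewrite -[Y in measurable Y]setTI; exact: mX.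
pose c j (B : 'I_n.+1 -> set R) :=
  \prod_(i < n.+1 | (j < i)%N) P (X i @^-1` B i).
have cfin j B : (forall i, measurable (B i)) -> c j B \is a fin_num.
  move=> mB; apply: (big_ind (fun x => x \is a fin_num)) => // [x y|i _].
    exact: fin_numM.
  exact: PX.
have c0 j B : 0 <= c j B.
  by apply: (big_ind (fun x => 0 <= x)) => // x y; exact: mule_ge0.
(* Keeping the events on the later variables makes the induction go through:
   it carries the independence of the partial sum from the remaining ones. *)
have main j : (j <= n)%N -> forall A (B : 'I_n.+1 -> set R),
    measurable A -> (forall i, measurable (B i)) ->
    P (S j @^-1` A `&` F j B) = (\int[mu]_(x in A) f j x) * c j B.
  elim: j => [_ A B mA mB|j ih jn A B mA mB].
    pose B' i := if i == ord0 then A else B i.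
    have mB' i : measurable (B' i) by rewrite /B'; case: ifP.
    have := indep (finset.setTfor 'I_n.+1) B' mB'.
    rewrite (_ : \bigcap_(i in _) _ = S 0%N @^-1` A `&` F 0%N B); last first.
      have SE w : S 0%N w = X ord0 w.
        rewrite /S (bigD1 ord0)//= big1 ?addr0// => i /andP[i0 iN].
        by move: iN; rewrite -val_eqE/=; lia.
      apply/seteqP; split => w /=.
        move=> H; split.
          by rewrite /preimage/= SE; exact: (H ord0 (finset.in_setT _)).
        move=> i i0; have := H i (finset.in_setT _); rewrite /B'/preimage/=.
        by case: ifPn => // /eqP ie; rewrite ie in i0.
      move=> [Aw Fw] i _; rewrite /B'/preimage/=; case: ifPn => [/eqP->|iN].
        by rewrite -SE.
      by apply: Fw; rewrite lt0n.
    move=> ->; rewrite (bigD1 ord0) ?finset.in_setT//=; congr (_ * _).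
      by rewrite /B' eqxx; exact: law.
    rewrite /B'; apply: eq_big => [i|i]; first by rewrite finset.in_setT/= lt0n.
    by rewrite finset.in_setT/= => /negbTE ->.
  pose i0 : 'I_n.+1 := Ordinal (jn : (j.+1 < n.+1)%N).
  have SE : S j.+1 = (fun w => S j w + X i0 w)%R.
    apply/funext => w; rewrite /S (bigD1 i0)//= addrC; congr (_ + _)%R.
    by apply: eq_bigl => i; rewrite -val_eqE/=; lia.
  have mfc : measurable_fun [set: R] (fun x => c j.+1 B * f 0%N x).
    exact: measurable_funeM.
  have fc0 x : 0 <= c j.+1 B * f 0%N x by rewrite mule_ge0.
  rewrite SE.
  transitivity (\int[mu]_(z in A) \int[mu]_x (f j x * (c j.+1 B * f 0%N (z - x)%R))).
    (* The measure is [P] restricted to the events on the later variables; their probability is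
       absorbed as a constant into the density of [X i0]. *)
    apply: (@sum_density _ _ T (mrestr P (mF j.+1 B mB)) (S j) (X i0) (f j)
      (fun x => c j.+1 B * f 0%N x)) => //.
    - rewrite /= /mrestr setTI ltey_eq fin_num_measure//; exact/mF.
    - move=> A1 A2 mA1 mA2.
      (* The event on the new variable is passed to the induction hypothesis as one of its later
         events. *)
      pose B' i := if i == i0 then A2 else B i.
      have mB' i : measurable (B' i) by rewrite /B'; case: ifP.
      have := ih (ltnW jn) A1 B' mA1 mB'.
      rewrite /= /mrestr -setIA (_ : F j B' = X i0 @^-1` A2 `&` F j.+1 B); last first.
        apply/seteqP; split => w /=.
          move=> H; split.
            by have := H i0 (leqnn _); rewrite /B' eqxx.
          move=> i ij; have := H i (ltnW ij); rewrite /B'; case: ifPn => // /eqP ie.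
          by rewrite ie /= ltnn in ij.
        move=> [H1 H2] i ij; rewrite /B'; case: ifPn => [/eqP->//|iN].
        by apply: H2; move: iN; rewrite -val_eqE/=; lia.
      move=> ->; congr (_ * _).
      rewrite ge0_integralZl//.
      rewrite muleC /c (bigD1 i0)//=; congr (_ * _).
        by rewrite /B' eqxx; exact: law.
      rewrite /B'; apply: eq_big => [i|i /andP[_ /negbTE->]//].
        by rewrite -val_eqE/=; lia.
      exact: (measurable_funTS (mf _)).
  under eq_integral => z _.
    under eq_integral => x _ do rewrite muleCA.
    rewrite ge0_integralZl//; last 2 first.
    - by have mf0 := mf 0%N; have mfj := mf j; meas.
    - by move=> x _; rewrite mule_ge0.
    rewrite conv; over.
  rewrite ge0_integralZl//; first by rewrite muleC.
  exact: (measurable_funTS (mf _)).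
move=> A mA; have := main n (leqnn n) A (fun=> setT) mA (fun=> measurableT).
rewrite /c [X in _ * X]big1; last by move=> i; rewrite ltnNge -ltnS ltn_ord.
rewrite mule1 => <-; congr (P _).
have SE w : S n w = (\sum_(i < n.+1) X i w)%R.
  by apply: eq_bigl => i; rewrite -ltnS ltn_ord.
apply/seteqP; split => w; rewrite /preimage/= SE; last by case.
by move=> Aw; split.
Qed.

End independent_sums.

(** * Moments *)

Section half_moments.
Context (R : realType).
Local Notation mu := (@lebesgue_measure R).
Local Open Scope ereal_scope.
Implicit Types k p q w c theta rho : R.

Lemma integral_ppow_gauss k c : (-1 < k)%R -> (0 < c)%R ->
  \int[mu]_q (ppow k q * expR (- (c * q ^+ 2)))%:E =
  (2^-1 * (c `^ (- ((k + 1) / 2)) * Gamma ((k + 1) / 2)))%:E.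
Proof.
move=> k1 c0.
have k0 : (0 < (k + 1) / 2)%R by rewrite divr_gt0//; lra.
rewrite EFinM -integral_ppow_expR// [in RHS]ge0_integral_sqr; last 3 first.
- by meas.
- by meas.
- by move=> x x0; rewrite ppow_neg// mul0r.
rewrite -ge0_integralZl_EFin//; [|by meas..].
apply: eq_integral => q _; rewrite -!EFinM; congr EFin.
have [q0|q0] := ltP 0%R q; last by rewrite !(ppow_neg _ q0) !(mulr0, mul0r).
have E : (q `^ k = (q ^+ 2) `^ ((k + 1) / 2 - 1) * q `^ 1)%R.
  rewrite -powR_mulrn ?(ltW q0)// -powRrM -powRD; last by rewrite (gt_eqF q0) implybT.
  by congr (_ `^ _)%R; field.
by rewrite !ppow_pos ?exprn_gt0// E; field.
Qed.

(** After Tonelli, q carries a Gaussian moment and w a Gamma integral. The parameter has two uses: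
    theta = 1 gives the moments of [vg], and theta = 1 - rho a bound for the tilted ones. *)
Lemma half_moment_kernel theta p k : (0 < theta)%R -> (-1 < k)%R ->
  (0 < p + k / 2)%R ->
  \int[mu]_q ((ppow k q)%:E * \int[mu]_w (ppow (p - 3 / 2) w *
      expR (- (theta * (w + q ^+ 2 * ppow (-1) w))))%:E) =
  (2^-1 * theta `^ (- ((k + 1) / 2)) * theta `^ (- (p + k / 2)) *
   (Gamma ((k + 1) / 2) * Gamma (p + k / 2)))%:E.
Proof.
move=> t0 k1 pk.
under eq_integral => q _.
  rewrite -ge0_integralZl_EFin//; [over|by meas..].
rewrite (@fubini_tonelli _ _ _ _ _ mu mu (fun z => (ppow k z.1)%:E *
  (ppow (p - 3 / 2) z.2 * expR (- (theta * (z.2 + z.1 ^+ 2 * ppow (-1) z.2))))%:E))/=; [|by meas..].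
transitivity (\int[mu]_w ((2^-1 * theta `^ (- ((k + 1) / 2)) * Gamma ((k + 1) / 2))%:E *
   (ppow (p + k / 2 - 1) w * expR (- (theta * w)))%:E)); last first.
  rewrite ge0_integralZl_EFin//; [|by meas..|]; last first.
    rewrite !mulr_ge0 ?powR_ge0 ?invr_ge0// ltW// Gamma_gt0//.
    by rewrite divr_gt0//; lra.
  rewrite integral_ppow_expR// -EFinM; congr EFin.
  by rewrite -!mulrA; do 2 congr (_ * _)%R; rewrite mulrCA.
apply: eq_integral => w _.
have [w0|w0] := ltP 0%R w; last first.
  rewrite (@ppow_neg _ (p + k / 2 - 1)%R)// mul0r mule0 integral0_eq// => q _.
  by rewrite (@ppow_neg _ _ w)// mul0r mule0.
transitivity (\int[mu]_q ((ppow (p - 3 / 2) w * expR (- (theta * w)))%:E *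
   (ppow k q * expR (- (theta / w * q ^+ 2)))%:E)).
  apply: eq_integral => q _; rewrite -!EFinM; congr EFin.
  rewrite mulrCA -[RHS]mulrA; congr (_ * _)%R; rewrite mulrCA; congr (_ * _)%R.
  rewrite -expRD; congr expR; rewrite ppow_pos// powR_inv1 ?(ltW w0)//.
  by field; rewrite gt_eqF.
have tw : (0 < theta / w)%R by rewrite divr_gt0.
rewrite ge0_integralZl_EFin//; [|by meas..].
rewrite integral_ppow_gauss// -!EFinM; congr EFin.
rewrite (_ : (theta / w) `^ (- ((k + 1) / 2)) =
  theta `^ (- ((k + 1) / 2)) * ppow ((k + 1) / 2) w)%R; last first.
  rewrite powRM ?invr_ge0 ?(ltW t0) ?(ltW w0)//; congr (_ * _)%R.
  rewrite -powR_inv1 ?(ltW w0)// -powRrM ppow_pos//; congr (_ `^ _)%R; ring.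
rewrite (_ : p + k / 2 - 1 = (p - 3 / 2) + (k + 1) / 2)%R; last by field.
rewrite -[ppow (_ + (k + 1) / 2)%R w]ppowM; ring.
Qed.

Lemma half_moment0 p k : (-1 < k)%R -> (0 < p + k / 2)%R ->
  \int[mu]_q ((ppow k q)%:E * vg p q) =
  (2^-1 * (Gamma ((k + 1) / 2) * Gamma (p + k / 2)))%:E.
Proof.
move=> k1 pk; have := half_moment_kernel ltr01 k1 pk.
rewrite !powR1 !mulr1 => <-; apply: eq_integral => q _; congr (_ * _).
by apply: eq_integral => w _; rewrite mul1r opprD.
Qed.

(** As 2 q <= w + q^2/w, the tilt consumes at most a proportion rho of the exponent; the kernel with
    theta = 1 - rho therefore dominates. *)
Lemma half_moment_fin rho p k : (0 <= rho)%R -> (rho < 1)%R -> (-1 < k)%R ->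
  (0 < p + k / 2)%R ->
  \int[mu]_q ((ppow k q * expR (2 * rho * q))%:E * vg p q) < +oo.
Proof.
move=> rho0 rho1 k1 pk.
have t0 : (0 < 1 - rho)%R by rewrite subr_gt0.
have mv := @measurable_vg R p.
have v0 := @vg_ge0 R p.
pose K w q : R := (ppow (p - 3 / 2) w *
  expR (- ((1 - rho) * (w + q ^+ 2 * ppow (-1) w))))%R.
have K0 w q : (0 <= K w q)%R by rewrite /K; meas.
have mK : measurable_fun [set: R] (fun q => \int[mu]_w (K w q)%:E).
  apply: (@measurable_fun_fubini_tonelli_F _ _ _ _ R mu (fun z => (K z.2 z.1)%:E)).
    by rewrite /K; meas.
  by move=> z; rewrite lee_fin.
have := half_moment_kernel t0 k1 pk => E.
apply: (@le_lt_trans _ _ (\int[mu]_q ((ppow k q)%:E * \int[mu]_w (K w q)%:E)));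
  last by rewrite E ltry.
apply: ge0_le_integral => //.
- by meas.
- by meas.
- by meas.
move=> q _; rewrite EFinM -muleA lee_wpmul2l//; first by meas.
have mvk : measurable_fun [set: R] (fun w => (vg_kernel p w q)%:E).
  by apply/measurable_EFinP; exact: measurable_vg_kernel.
rewrite /vg -ge0_integralZl_EFin ?expR_ge0//; last first.
  by move=> w _; rewrite lee_fin vg_kernel_ge0.
apply: ge0_le_integral => //.
- by move=> w _; rewrite mule_ge0 ?lee_fin ?expR_ge0 ?vg_kernel_ge0.
- by rewrite /vg_kernel; meas.
- by rewrite /K; meas.
move=> w _; rewrite -EFinM lee_fin /vg_kernel /K mulrCA.
have [w0|w0] := ltP 0%R w; last by rewrite (@ppow_neg _ _ w)// !mul0r.
rewrite ler_wpM2l ?ppow_ge0// -expRD ler_expR ppow_pos// powR_inv1 ?(ltW w0)//.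
have H : (0 <= (w - q) ^+ 2 / w)%R by rewrite divr_ge0 ?sqr_ge0// ltW.
have {}H : (2 * q <= w + q ^+ 2 / w)%R.
  rewrite -subr_ge0 (_ : _ - _ = (w - q) ^+ 2 / w)%R//.
  by field; rewrite gt_eqF.
by move: (q ^+ 2 / w)%R H => y H; nra.
Qed.

End half_moments.

(** * Termwise integration and the hypergeometric series *)

Section hypergeometric_series.
Context (R : realType).
Local Notation mu := (@lebesgue_measure R).
Implicit Types k p q x rho a b : R.

(** The limit is 2 cosh for m = 0 and 2 sinh for m = 1. Partial sums of even length are grouped in
    pairs, and in each pair the term of the wrong parity cancels. *)
Lemma expR_parity_cvg (m : bool) x :
  (\sum_(0 <= j < n) 2 * (x ^+ (j.*2 + m) / (j.*2 + m)`!%:R)) @[n --> \oo] -->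
  expR x + (-1) ^+ m * expR (- x).
Proof.
have H (y : R) : series (exp_coeff y) n.*2 @[n --> \oo] --> expR y.
  apply: (cvg_comp _ (series (exp_coeff y))); last exact: is_cvg_series_exp_coeff.
  apply/cvgnyPge => A; exists A => //= n /= An.
  by rewrite -addnn (leq_trans An)// leq_addr.
rewrite (_ : (fun n => _) = (fun n => series (exp_coeff x) n.*2 +
  (-1) ^+ m * series (exp_coeff (- x)) n.*2)).
  by apply: cvgD; [exact: H|apply: cvgMr; exact: H].
apply/funext => n; apply/esym.
have pair (u : nat -> R) : series u n.*2 = \sum_(0 <= j < n) (u j.*2 + u j.*2.+1).
  elim: n => [|n ih]; first by rewrite /series/= !big_geq.
  by rewrite doubleS !seriesSr ih big_nat_recr//= addrA.
rewrite !pair mulr_sumr -big_split/=; apply: eq_bigr => j _.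
rewrite /exp_coeff/= !(exprNn x) !exprS.
rewrite (_ : (-1) ^+ j.*2 = 1 :> R); last by rewrite -mul2n exprM sqrrN expr1n expr1n.
case: m; rewrite ?addn1 ?addn0 ?expr1 ?expr0 ?exprS.
  by move: (x ^+ _) (_`!%:R)^-1 (_`!%:R)^-1 => X f0 f1; ring.
by move: (x ^+ _) (_`!%:R)^-1 (_`!%:R)^-1 => X f0 f1; ring.
Qed.

Lemma expR_parity_series (m : bool) x : 0 <= x ->
  (\sum_(j <oo) (2 * (x ^+ (j.*2 + m) / (j.*2 + m)`!%:R))%:E)%E =
  (expR x + (-1) ^+ m * expR (- x))%:E.
Proof.
move=> x0; apply/cvg_lim => //.
under eq_fun do rewrite sumEFin.
by apply: cvg_EFin; [near=> n|exact: expR_parity_cvg].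
Unshelve. all: by end_near. Qed.

Lemma ascending_factorialS a j :
  ascending_factorial a j.+1 = ascending_factorial a j * (a + j%:R).
Proof. by rewrite /ascending_factorial big_ord_recr. Qed.

Lemma ascending_factorial_gt0 a j : 0 < a -> 0 < ascending_factorial a j.
Proof. by move=> a0; apply: prodr_gt0 => i _; rewrite ltr_wpDr. Qed.

Lemma Gamma_shift a j : 0 < a ->
  Gamma (a + j%:R) = Gamma a * ascending_factorial a j.
Proof.
move=> a0; elim: j => [|j ih].
  by rewrite addr0 /ascending_factorial big_ord0 mulr1.
rewrite -natr1 addrA GammaS ?ih ?ascending_factorialS; first by ring.
by rewrite ltr_wpDr.
Qed.

(** This separation of even and odd factors is the source of the lower parameter 1/2 + m. The factor
    4^j will cancel against (2 rho)^(2 j), leaving the argument rho^2. *)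
Lemma fact_ascending_factorial (m : bool) j :
  (j.*2 + m)`!%:R = 4 ^+ j * j`!%:R * ascending_factorial (1 / 2 + m%:R) j :> R.
Proof.
elim: j => [|j ih].
  by rewrite /ascending_factorial big_ord0 expr0 !mulr1; case: m.
rewrite doubleS !addSn !factS !natrM ih exprS ascending_factorialS.
rewrite -!natr1 natrD -muln2 natrM.
move: (_ ^+ _) (j`!%:R) (ascending_factorial _ _) => X Y Z.
by case: m {ih} => /=; field.
Qed.

Definition hyp2F1_term a b c x (j : nat) : R :=
  ascending_factorial a j * ascending_factorial b j / ascending_factorial c j
  * (x ^+ j / j`!%:R).

(* Finiteness of the extended-real sum gives the convergence without which
   [limn] would be a junk value. *)
Lemma nneseries_scale (u : nat -> R) (C : R) : (forall j, 0 <= C * u j) ->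
  (\sum_(j <oo) (C * u j)%:E < +oo)%E ->
  (\sum_(j <oo) (C * u j)%:E)%E = (C * limn (series u))%:E.
Proof.
(* For C = 0 the hypotheses say nothing about [u], but both sides vanish. This happens for odd
   moments at rho = 0. *)
move=> Cu0; have [->|C0] := eqVneq C 0.
  by move=> _; rewrite mul0r eseries0// => j _ _; rewrite mul0r.
move=> fin.
have sE n : (series (fun j => C * u j) n)%:E = (\sum_(0 <= j < n) (C * u j)%:E)%E.
  by rewrite sumEFin.
have cv : cvgn (series (fun j => C * u j)).
  apply: nondecreasing_is_cvgn; first exact: nondecreasing_series.
  exists (fine (\sum_(j <oo) (C * u j)%:E)%E) => _ [n _ <-].
  rewrite -lee_fin fineK; last first.
    by rewrite ge0_fin_numE// nneseries_ge0// => j _ _; rewrite lee_fin.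
  by rewrite sE; apply: nneseries_lim_ge => j _ _; rewrite lee_fin.
have cu : cvgn (series u).
  rewrite (_ : u = C^-1 *: (fun j => C * u j)); first exact: is_cvg_seriesZ.
  by apply/funext => j; rewrite -[RHS]/(C^-1 * (C * u j)) mulrA mulVf// mul1r.
have E : limn (series (fun j => C * u j)) = C * limn (series u).
  exact: (lim_seriesZ C cu).
rewrite -E.
rewrite -EFin_lim//; congr (limn _); apply/funext => n /=.
by rewrite -sE.
Qed.

(** Seen as an integral for the counting measure, the series admits an infinite factor [V], such as
    a value of [vg]. *)
Lemma nneseriesMr (a : nat -> \bar R) (V : \bar R) :
  (forall j, 0 <= a j)%E -> (0 <= V)%E ->
  (\sum_(j <oo) (a j * V) = (\sum_(j <oo) a j) * V)%E.
Proof.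
move=> a0 V0.
have aV0 j : (0 <= a j * V)%E by rewrite mule_ge0.
by rewrite -(ge0_integral_count aV0) -(ge0_integral_count a0) ge0_integralZr.
Qed.

(** The term of order 2 j + m raises the exponent k by 2 j + m, hence both Gamma arguments by j
    beyond their values at j = 0; [Gamma_shift] turns this into ascending factorials. *)
Lemma half_moment_series (m : bool) rho p k : 0 <= rho -> -1 < k ->
  0 < p + k / 2 ->
  (\int[mu]_q ((ppow k q *
     (expR (2 * rho * q) + (-1) ^+ m * expR (- (2 * rho * q))))%:E * vg p q) =
  \sum_(j <oo) ((2 * rho) ^+ m * Gamma ((k + 1 + m%:R) / 2) *
     Gamma (p + (k + m%:R) / 2) *
     hyp2F1_term ((k + 1 + m%:R) / 2) (p + (k + m%:R) / 2) (1 / 2 + m%:R)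
       (rho ^+ 2) j)%:E)%E.
Proof.
move=> rho0 k1 pk.
have v0 := @vg_ge0 R p; have mv := @measurable_vg R p.
pose c j : R := 2 * ((2 * rho) ^+ (j.*2 + m) / (j.*2 + m)`!%:R).
have c0 j : 0 <= c j by rewrite /c !mulr_ge0 ?exprn_ge0 ?mulr_ge0 ?invr_ge0.
transitivity (\int[mu]_q (\sum_(j <oo)
    ((c j)%:E * ((ppow (k + (j.*2 + m)%:R) q)%:E * vg p q))))%E.
  apply: eq_integral => q _.
  have [q0|q0] := ltP 0 q; last first.
    rewrite ppow_neg// mul0r mul0e eseries0// => j _ _.
    by rewrite ppow_neg// mul0e mule0.
  have x0 : 0 <= 2 * rho * q by rewrite !mulr_ge0// ltW.
  pose u j : R := 2 * ((2 * rho * q) ^+ (j.*2 + m) / (j.*2 + m)`!%:R).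
  have u0 j : (0 <= (u j)%:E)%E by rewrite lee_fin /u !mulr_ge0 ?exprn_ge0 ?invr_ge0.
  rewrite EFinM -(expR_parity_series m x0) -muleA -(nneseriesMr u0)//.
  rewrite -nneseriesZl; last first.
    by move=> j _; rewrite mule_ge0.
  apply: eq_eseriesr => j _; rewrite !muleA -!EFinM; congr (_%:E * _)%E.
  rewrite /u /c exprMn -(ppowM k) (ppow_pos (_ + _)%:R q0) powR_mulrn ?(ltW q0)//.
  by move: (_`!%:R)^-1 => X; ring.
rewrite integral_nneseries//; last 2 first.
- by move=> j; meas.
- by move=> j q _; meas.
apply: eq_eseriesr => j _.
rewrite ge0_integralZl_EFin//; [|by meas..].
have k1j : -1 < k + (j.*2 + m)%:R by rewrite ltr_wpDr.
have pkj : 0 < p + (k + (j.*2 + m)%:R) / 2 by rewrite mulrDl addrA ltr_wpDr// divr_ge0.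
rewrite half_moment0// -EFinM; congr EFin.
rewrite /c fact_ascending_factorial.
rewrite (_ : (k + (j.*2 + m)%:R + 1) / 2 = (k + 1 + m%:R) / 2 + j%:R); last first.
  by rewrite natrD -muln2 natrM; field.
rewrite (_ : p + (k + (j.*2 + m)%:R) / 2 = p + (k + m%:R) / 2 + j%:R); last first.
  by rewrite natrD -muln2 natrM; field.
have m0 : 0 <= m%:R :> R by [].
have k1m : 0 < (k + 1 + m%:R) / 2 by rewrite divr_gt0//; lra.
have pkm : 0 < p + (k + m%:R) / 2 by lra.
have A0 : 0 < ascending_factorial (1 / 2 + m%:R) j :> R.
  by apply: ascending_factorial_gt0; rewrite ltr_wpDr.
rewrite !Gamma_shift// /hyp2F1_term exprD -muln2 mulnC exprM.
rewrite [(2 * rho) ^+ 2]exprMn (_ : 2 ^+ 2 = 4 :> R); last by ring.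
rewrite exprMn.
have F0 : j`!%:R != 0 :> R by rewrite pnatr_eq0 -lt0n fact_gt0.
have P4 : 4 ^+ j != 0 :> R by rewrite expf_neq0.
move: (4 ^+ j) (j`!%:R) F0 P4 (ascending_factorial (1 / 2 + _) j) A0 => X Y Y0 X0 W W0.
move: (Gamma _) (Gamma _) ((2 * rho) ^+ m) => G1 G2 X2.
move: (ascending_factorial _ j) (ascending_factorial _ j) (rho ^+ 2 ^+ j) => H1 H2 H3.
by field; rewrite X0 Y0 gt_eqF.
Qed.

(** For q > 0 the bracket is at most 2 e^(2 rho q), so [half_moment_fin] supplies the finiteness
    required by [nneseries_scale]. *)
Lemma half_moment (m : bool) rho p k : 0 <= rho -> rho < 1 -> -1 < k ->
  0 < p + k / 2 ->
  (\int[mu]_q ((ppow k q *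
     (expR (2 * rho * q) + (-1) ^+ m * expR (- (2 * rho * q))))%:E * vg p q) =
  ((2 * rho) ^+ m * Gamma ((k + 1 + m%:R) / 2) * Gamma (p + (k + m%:R) / 2) *
     hypergeometric2F1 ((k + 1 + m%:R) / 2) (p + (k + m%:R) / 2) (1 / 2 + m%:R)
       (rho ^+ 2))%:E)%E.
Proof.
move=> rho0 rho1 k1 pk.
have m0 : 0 <= m%:R :> R by [].
have k1m : 0 < (k + 1 + m%:R) / 2 by rewrite divr_gt0//; lra.
have pkm : 0 < p + (k + m%:R) / 2 by lra.
rewrite half_moment_series// nneseries_scale//.
  move=> j; rewrite mulr_ge0//; last first.
    rewrite /hyp2F1_term mulr_ge0 ?divr_ge0 ?exprn_ge0 ?mulr_ge0//; apply: ltW;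
    by apply: ascending_factorial_gt0 => //; rewrite ltr_wpDr.
  by rewrite !mulr_ge0 ?exprn_ge0 ?mulr_ge0// ltW// Gamma_gt0.
rewrite -half_moment_series//.
have v0 := @vg_ge0 R p; have mv := @measurable_vg R p.
apply: (@le_lt_trans _ _ (\int[mu]_q (2%:E *
    ((ppow k q * expR (2 * rho * q))%:E * vg p q)))%E); last first.
  rewrite ge0_integralZl_EFin//; [|by meas..].
  by apply: lte_mul_pinfty; [rewrite lee_fin| |exact: half_moment_fin].
have Bq q : 0 < q -> 0 <= expR (2 * rho * q) + (-1) ^+ m * expR (- (2 * rho * q)) <=
    2 * expR (2 * rho * q).
  move=> q0; have x0 : 0 <= 2 * rho * q by rewrite !mulr_ge0// ltW.
  have : expR (- (2 * rho * q)) <= expR (2 * rho * q) by rewrite ler_expR; lra.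
  have := expR_ge0 (- (2 * rho * q)); have := expR_ge0 (2 * rho * q).
  by case: m {m0 k1m pkm}; rewrite ?expr1 ?expr0 => ? ? ?; lra.
apply: ge0_le_integral => //.
- move=> q _; rewrite mule_ge0// lee_fin.
  have [q0|q0] := ltP 0 q; last by rewrite ppow_neg// mul0r.
  by rewrite mulr_ge0 ?ppow_ge0//; have /andP[] := Bq _ q0.
- by meas.
- by meas.
move=> q _; rewrite muleA lee_wpmul2r// -EFinM lee_fin.
have [q0|q0] := ltP 0 q; last by rewrite ppow_neg// !mul0r mulr0.
by rewrite mulrCA ler_wpM2l ?ppow_ge0//; have /andP[] := Bq _ q0.
Qed.

End hypergeometric_series.

(** * Absolute and signed moments of the densities *)

Section vg_moments.
Context (R : realType).
Local Notation mu := (@lebesgue_measure R).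
Local Open Scope ereal_scope.
Implicit Types k p q x rho : R.

(** Both sides are even in rho, so rho may be replaced by its absolute value. *)
Lemma half_moment_add rho p k : (-1 < rho)%R -> (rho < 1)%R -> (-1 < k)%R ->
  (0 < p + k / 2)%R ->
  \int[mu]_q ((ppow k q * (expR (2 * rho * q) + expR (- (2 * rho * q))))%:E * vg p q) =
  (Gamma ((k + 1) / 2) * Gamma (p + k / 2) *
     hypergeometric2F1 ((k + 1) / 2) (p + k / 2) (1 / 2) (rho ^+ 2))%:E.
Proof.
move=> rhoN1 rho1 k1 pk.
have r0 : (0 <= `|rho|)%R by [].
have r1 : (`|rho| < 1)%R by rewrite ltr_norml rhoN1.
have := half_moment false r0 r1 k1 pk.
rewrite /= !addr0 expr0 (mul1r (Gamma _)) real_normK ?num_real // => <-.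
apply: eq_integral => q _.
congr ((_ * _)%:E * _); rewrite mul1r.
by have [_|_] := ger0P rho; rewrite // mulrN mulNr opprK addrC.
Qed.

(** A difference of nonnegative integrals is the form in which an odd moment arises. Both sides are
    odd in rho, which reduces to rho >= 0; there the larger integral is the smaller one plus a
    nonnegative integral, and finiteness permits the cancellation. *)
Lemma half_moment_sub rho p k : (-1 < rho)%R -> (rho < 1)%R -> (-1 < k)%R ->
  (0 < p + k / 2)%R ->
  \int[mu]_q ((ppow k q * expR (2 * rho * q))%:E * vg p q) -
  \int[mu]_q ((ppow k q * expR (2 * - rho * q))%:E * vg p q) =
  (2 * rho * Gamma ((k + 2) / 2) * Gamma (p + (k + 1) / 2) *
     hypergeometric2F1 ((k + 2) / 2) (p + (k + 1) / 2) (1 / 2 + 1) (rho ^+ 2))%:E.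
Proof.
move=> + + k1 pk.
have v0 := @vg_ge0 R p; have mv := @measurable_vg R p.
pose H r := \int[mu]_q ((ppow k q * expR (2 * r * q))%:E * vg p q).
rewrite -/(H rho) -/(H (- rho)%R).
have pos r : (0 <= r)%R -> (r < 1)%R -> H r - H (- r)%R = (2 * r * Gamma ((k + 2) / 2) *
    Gamma (p + (k + 1) / 2) *
     hypergeometric2F1 ((k + 2) / 2) (p + (k + 1) / 2) (1 / 2 + 1) (r ^+ 2))%:E.
  move=> r0 r1.
  have := half_moment true r0 r1 k1 pk.
  rewrite /= expr1 -addrA => D.
  have Hr := half_moment_fin r0 r1 k1 pk.
  have Bq q : (0 <= ppow k q * (expR (2 * r * q) + (-1) ^+ 1 * expR (- (2 * r * q))))%R.
    have [q0|q0] := ltP 0%R q; last by rewrite ppow_neg// mul0r.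
    rewrite mulr_ge0 ?ppow_ge0// expr1 mulN1r subr_ge0 ler_expR.
    by have := mulr_ge0 r0 (ltW q0); lra.
  have HD : H r = H (- r)%R + \int[mu]_q ((ppow k q *
      (expR (2 * r * q) + (-1) ^+ 1 * expR (- (2 * r * q))))%:E * vg p q).
    rewrite /H -ge0_integralD//; last 4 first.
    - by move=> q _; meas.
    - by meas.
    - by move=> q _; rewrite mule_ge0// lee_fin.
    - by meas.
    apply: eq_integral => q _; rewrite -ge0_muleDl ?lee_fin//; last by meas.
    by rewrite -EFinD mulrN mulNr; congr (_%:E * _); ring.
  have HNfin : H (- r)%R \is a fin_num.
    rewrite ge0_fin_numE; last by rewrite /H; meas.
    apply: le_lt_trans Hr; rewrite -/(H r) HD leeDl//.
    by apply: integral_ge0 => q _; rewrite mule_ge0// lee_fin Bq.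
  by rewrite HD addeC addeK// D.
move=> rhoN1 rho1; have [rho0|rho0] := leP 0%R rho; first exact: pos.
have rN0 : (0 <= - rho)%R by rewrite oppr_ge0 ltW.
have rN1 : (- rho < 1)%R by rewrite ltrNl.
have := pos _ rN0 rN1; rewrite opprK sqrrN => E.
have Hf : H (- rho)%R \is a fin_num.
  rewrite ge0_fin_numE; last by rewrite /H; meas.
  exact: half_moment_fin.
rewrite -[LHS]oppeK oppeB; last by rewrite fin_num_adde_defl ?fin_numN.
rewrite (addeC (- H rho)) E -EFinN; congr EFin.
by rewrite mulrN !mulNr opprK.
Qed.

Lemma abs_moment rho p k : (-1 < rho)%R -> (rho < 1)%R -> (-1 < k)%R ->
  (0 < p)%R -> (0 < p + k / 2)%R ->
  \int[mu]_x ((`|x| `^ k)%R%:E * vg_pdf rho p x) =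
  ((1 - rho ^+ 2) `^ p / (Num.sqrt pi * Gamma p) *
   (Gamma ((k + 1) / 2) * Gamma (p + k / 2) *
     hypergeometric2F1 ((k + 1) / 2) (p + k / 2) (1 / 2) (rho ^+ 2)))%:E.
Proof.
move=> rhoN1 rho1 k1 p0 pk.
have v0 := @vg_ge0 R p; have mv := @measurable_vg R p.
have mf := @measurable_vg_pdf R rho p.
have f0 x := @vg_pdf_ge0 R rho p x p0.
rewrite EFinM -half_moment_add// ge0_integral_symmetrize//; last 2 first.
- apply: emeasurable_funM => //; apply/measurable_EFinP.
  by apply: (measurableT_comp (@measurable_powR _ k)).
- by move=> x; rewrite mule_ge0// lee_fin powR_ge0.
have K0 : (0 <= (1 - rho ^+ 2) `^ p / (Num.sqrt pi * Gamma p))%R.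
  rewrite mulr_ge0 ?powR_ge0// invr_ge0 mulr_ge0 ?sqrtr_ge0//.
  by rewrite ltW// Gamma_gt0.
rewrite -ge0_integralZl_EFin//; [|by meas..].
apply: eq_integral => x _.
have [x0|x0] := ltP 0%R x; last by rewrite !(ppow_neg _ x0) !mul0r !mul0e mule0.
rewrite normrN -ge0_muleDr// /vg_pdf vgN -ge0_muleDl; last 2 first.
- by rewrite lee_fin vg_pdf_coef_ge0.
- by rewrite lee_fin vg_pdf_coef_ge0.
rewrite !(ppow_pos _ x0) powRr0 mul1e gtr0_norm//.
rewrite -!EFinD muleA -!EFinM muleA -EFinM mulrN; congr (_%:E * _); ring.
Qed.

(** Reflecting the negative half-line replaces rho by -rho in the tilt, since [vg] is even. *)
Lemma signed_moment rho p k : (-1 < rho)%R -> (rho < 1)%R -> (-1 < k)%R ->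
  (0 < p)%R -> (0 < p + k / 2)%R ->
  \int[mu]_x ((ppow k x)%:E * vg_pdf rho p x) -
  \int[mu]_x ((ppow k (- x))%:E * vg_pdf rho p x) =
  ((1 - rho ^+ 2) `^ p / (Num.sqrt pi * Gamma p) *
   (2 * rho * Gamma ((k + 2) / 2) * Gamma (p + (k + 1) / 2) *
     hypergeometric2F1 ((k + 2) / 2) (p + (k + 1) / 2) (1 / 2 + 1) (rho ^+ 2)))%:E.
Proof.
move=> rhoN1 rho1 k1 p0 pk.
have v0 := @vg_ge0 R p; have mv := @measurable_vg R p.
have mf := @measurable_vg_pdf R rho p.
have f0 x := @vg_pdf_ge0 R rho p x p0.
pose C : R := ((1 - rho ^+ 2) `^ p / (Num.sqrt pi * Gamma p))%R.
have C0 : (0 <= C)%R.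
  rewrite mulr_ge0 ?powR_ge0// invr_ge0 mulr_ge0 ?sqrtr_ge0//.
  by rewrite ltW// Gamma_gt0.
have E r : \int[mu]_q ((ppow k q)%:E * ((C * expR (2 * r * q))%:E * vg p q)) =
    C%:E * \int[mu]_q ((ppow k q * expR (2 * r * q))%:E * vg p q).
  rewrite -ge0_integralZl_EFin//; [|by meas..].
  by apply: eq_integral => q _; rewrite !muleA -!EFinM mulrCA.
have E1 : \int[mu]_x ((ppow k (- x))%:E * vg_pdf rho p x) =
  \int[mu]_q ((ppow k q)%:E * ((C * expR (2 * - rho * q))%:E * vg p q)).
  rewrite -[LHS]ge0_integral_opp; [|by meas..].
  apply: eq_integral => q _; rewrite opprK /vg_pdf vgN -/C.
  by rewrite (_ : 2 * - rho * q = 2 * rho * - q)%R//; ring.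
have E0 : \int[mu]_x ((ppow k x)%:E * vg_pdf rho p x) =
  C%:E * \int[mu]_q ((ppow k q * expR (2 * rho * q))%:E * vg p q) := E rho.
have D := half_moment_sub rhoN1 rho1 k1 pk.
rewrite E0 E1 E -/C {E E0 E1}.
move: (integral _ _ _) (integral _ _ _) D => I2 I1 D.
have : I1 - I2 \is a fin_num by rewrite D.
rewrite fin_numB => /andP[_ I2fin].
rewrite [RHS]EFinM -D {D} muleBr ?fin_num_adde_defl ?fin_numN//.
Qed.

End vg_moments.

(** * Transfer to the sample mean *)

Lemma integral_density_law (R : realType) d (T : measurableType d)
    (P : {measure set T -> \bar R}) (X : T -> R) (f : R -> \bar R) :
  measurable_fun [set: T] X ->
  measurable_fun [set: R] f -> (forall x, 0 <= f x)%E ->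
  (forall A : set R, measurable A ->
    P (X @^-1` A) = \int[lebesgue_measure]_(x in A) f x)%E ->
  forall h : R -> \bar R, measurable_fun [set: R] h -> (forall x, 0 <= h x)%E ->
  (\int[P]_w h (X w) = \int[lebesgue_measure]_x (h x * f x))%E.
Proof.
move=> mX mf f0 law h mh h0.
have mX' : measurable_fun [set: T] (X : T -> measurableTypeR R) by exact: mX.
have [m' [m'E m'I]] := pushforward_measure_exists P mX'.
rewrite -m'I//.
pose nu := density_measure (@lebesgue_measure R) mf f0.
rewrite -(integral_density_measure (@lebesgue_measure R) mf f0 mh h0).
apply: eq_measure_integral => A mA _; rewrite m'E; exact: law.
Qed.

Lemma product_sum_law (R : realType) d (T : measurableType d)
    (P : probability T R) (U V : {RV P >-> R}) (s1 s2 rho : R)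
    d' (T' : measurableType d') (P' : probability T' R) (n : nat)
    (Z : 'I_n.+1 -> {RV P' >-> R}) :
  0 < s1 -> 0 < s2 -> -1 < rho -> rho < 1 ->
  is_bivariate_normal P U V 0 0 s1 s2 rho ->
  mutually_independent P' (fun i => Z i : T' -> R) ->
  (forall i, identically_distributed P' (Z i) P (fun w => U w * V w)) ->
  forall A : set R, measurable A ->
    (P' ((fun w => \sum_(i < n.+1) (Z i w / (2 * (s1 * s2) * (1 - rho ^+ 2))))%R @^-1` A) =
    \int[lebesgue_measure]_(x in A) vg_pdf rho (n.+1%:R / 2) x)%E.
Proof.
move=> s10 s20 rhoN1 rho1 UVn indep copies A mA.
set tau := 2 * (s1 * s2) * (1 - rho ^+ 2).
have mdiv : measurable_fun [set: R] (fun z => z / tau) by meas.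
have mpre (B : set R) : measurable B -> measurable ((fun z => z / tau) @^-1` B).
  by move=> mB; rewrite -[X in measurable X]setTI; exact: mdiv.
apply: (independent_sum_density (P := P') (X := fun i w => Z i w / tau)
  (f := fun j => vg_pdf rho (j.+1%:R / 2))) => //.
- by move=> i; exact: measurable_funM.
- by move=> J B mB; exact: (indep J (fun i => (fun z => z / tau) @^-1` B i)
    (fun i => mpre _ (mB i))).
- by move=> j; exact: measurable_vg_pdf.
- by move=> j x; rewrite vg_pdf_ge0// divr_gt0.
- move=> i B mB.
  rewrite -(bivariate_normal_product_law s10 s20 rhoN1 rho1 UVn mB).
  exact: (copies i _ (mpre _ mB)).
- move=> j x; rewrite vg_pdf_convolution ?divr_gt0//.
  by congr vg_pdf; rewrite -[j.+2%:R]natr1; field.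
Qed.

(** It gives l = (k + 1 + m) / 2, the form of the Gamma arguments in [half_moment]. *)
Lemma ceil_half (R : realType) (k : nat) :
  (Num.ceil (k%:R / 2 : R))%:~R = (k%:R + (k %% 2)%:R) / 2 :> R.
Proof.
have kE : k%:R = (odd k)%:R + k./2%:R * 2 :> R.
  by rewrite -natrM -natrD muln2 odd_double_half.
rewrite modn2 kE (_ : Num.ceil _ = (odd k + k./2)%N%:Z).
  by rewrite -pmulrn natrD; field.
apply: ceil_def; rewrite rmorphB/= -pmulrn natrD.
by case: (odd k) => /=; apply/andP; split; lra.
Qed.

Theorem corollary2p4 (R : realType)
  (d : measure_display) (T : measurableType d) (P : probability T R)
  (U V : {RV P >-> R}) (sigmaU sigmaV rho : R)
  (sigmaU_gt0 : 0 < sigmaU) (sigmaV_gt0 : 0 < sigmaV)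
  (rho_gtN1 : -1 < rho) (rho_lt1 : rho < 1)
  (UV_normal : is_bivariate_normal P U V 0 0 sigmaU sigmaV rho)
  (d' : measure_display) (T' : measurableType d') (P' : probability T' R)
  (n : nat) (n_ge1 : (1 <= n)%N) (Z : 'I_n -> {RV P' >-> R})
  (Z_indep : mutually_independent P' (fun i => Z i : T' -> R))
  (Z_copies : forall i : 'I_n,
     identically_distributed P' (Z i) P (fun w => U w * V w)) :
  let s := sigmaU * sigmaV in
  let Zbar := sample_mean (fun i => Z i : T' -> R) in
  (forall k : R, -1 < k ->
     ('E_P'[fun w => (`|Zbar w| `^ k)%R])%E =
     ((2 * s / n%:R) `^ k * (1 - rho ^+ 2) `^ (n%:R / 2 + k)
      / (Num.sqrt pi * Gamma (n%:R / 2))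
      * Gamma ((n%:R + k) / 2) * Gamma ((k + 1) / 2)
      * hypergeometric2F1 ((k + 1) / 2) ((n%:R + k) / 2) (1 / 2)
          (rho ^+ 2))%:E) /\
  (forall k : nat, (0 < k)%N ->
     let l : R := (Num.ceil (k%:R / 2 : R))%:~R + 1 / 2 in
     let m : nat := (k %% 2)%N in
     ('E_P'[fun w => (Zbar w ^+ k)%R])%E =
     ((2 * s / n%:R) ^+ k * (2 * rho) ^+ m
      * (1 - rho ^+ 2) `^ (n%:R / 2 + k%:R)
      / (Num.sqrt pi * Gamma (n%:R / 2))
      * Gamma ((n%:R - 1) / 2 + l) * Gamma l
      * hypergeometric2F1 l ((n%:R - 1) / 2 + l) (1 / 2 + m%:R)
          (rho ^+ 2))%:E).
Proof.
case: n n_ge1 Z Z_indep Z_copies => // n _ Z Z_indep Z_copies s Zbar.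
have rho2 : 0 < 1 - rho ^+ 2 := one_sub_sqr_gt0 rho_gtN1 rho_lt1.
have s0 : 0 < s by rewrite mulr_gt0.
pose N : R := n.+1%:R; rewrite -/N.
have N0 : 0 < N by rewrite ltr0n.
have N1 : 1 <= N by rewrite ler1n.
pose tau := 2 * s * (1 - rho ^+ 2).
have tau0 : 0 < tau by rewrite !mulr_gt0.
(* The mean is c times the sum of the rescaled copies. Since c = (2 s / N) (1 - rho^2), its k-th
   power supplies the prefactor and the additional k in the exponent of 1 - rho^2. *)
pose c := tau / N; have c0 : 0 < c by rewrite divr_gt0.
pose S w := \sum_(i < n.+1) (Z i w / tau).
have ZbarE w : Zbar w = c * S w.
  rewrite /Zbar /sample_mean /S -mulr_suml /c -/N; field.
  by rewrite !gt_eqF.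
have mS : measurable_fun [set: T'] S.
  by apply: measurable_sum => i; exact: measurable_funM.
have p0 : 0 < N / 2 by rewrite divr_gt0.
have mf := @measurable_vg_pdf R rho (N / 2).
have f0 x := @vg_pdf_ge0 R rho (N / 2) x p0.
have law := integral_density_law mS mf f0
  (product_sum_law sigmaU_gt0 sigmaV_gt0 rho_gtN1 rho_lt1 UV_normal Z_indep Z_copies).
have part1 (k : R) : -1 < k ->
     ('E_P'[fun w => (`|Zbar w| `^ k)%R])%E =
     ((2 * s / N) `^ k * (1 - rho ^+ 2) `^ (N / 2 + k)
      / (Num.sqrt pi * Gamma (N / 2))
      * Gamma ((N + k) / 2) * Gamma ((k + 1) / 2)
      * hypergeometric2F1 ((k + 1) / 2) ((N + k) / 2) (1 / 2)
          (rho ^+ 2))%:E.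
  move=> k1; rewrite unlock.
  transitivity (\int[P']_w ((c `^ k)%:E * (`|S w| `^ k)%:E))%E.
    apply: eq_integral => w _; rewrite ZbarE normrM (gtr0_norm c0) -EFinM.
    by rewrite powRM// ltW.
  have mpow : measurable_fun [set: R] (fun x => (`|x| `^ k)%:E).
    apply/measurable_EFinP.
    by apply: (measurableT_comp (@measurable_powR _ k)).
  have mcpow : measurable_fun [set: R] (fun x => ((c `^ k)%:E * (`|x| `^ k)%:E)%E).
    exact: measurable_funeM.
  rewrite (law (fun x => ((c `^ k)%:E * (`|x| `^ k)%:E)%E)); last 2 first.
  - exact: mcpow.
  - by move=> x; rewrite mule_ge0// lee_fin powR_ge0.
  under eq_integral do rewrite -muleA.
  rewrite ge0_integralZl_EFin//; last 3 first.
  - by move=> x _; rewrite mule_ge0// lee_fin powR_ge0.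
  - exact: emeasurable_funM.
  - exact: powR_ge0.
  rewrite abs_moment//; last by lra.
  rewrite -EFinM; congr EFin.
  rewrite (_ : N / 2 + k / 2 = (N + k) / 2); last by rewrite mulrDl.
  rewrite (_ : c = 2 * s / N * (1 - rho ^+ 2)); last first.
    by rewrite /c /tau mulrAC.
  rewrite powRM ?ltW ?divr_gt0 ?mulr_gt0//.
  rewrite powRD; last by rewrite (gt_eqF rho2) implybT.
  ring.
split => // k k0 l m.
have lE : l = (k%:R + 1 + m%:R) / 2 by rewrite /l ceil_half -/m; field.
have lE' : (N - 1) / 2 + l = N / 2 + (k%:R + m%:R) / 2 by rewrite lE; field.
have k1 : -1 < k%:R :> R by rewrite (lt_le_trans _ (ler0n _ _))// ltrN10.
have pk : 0 < N / 2 + k%:R / 2 by rewrite ltr_wpDr// divr_ge0.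
rewrite lE' lE {l lE lE'} /m modn2.
(* For even k the power equals the absolute power and m = 0, so the first formula applies. *)
have [ok|ek] := boolP (odd k); last first.
  transitivity ('E_P'[fun w => (`|Zbar w| `^ k%:R)%R])%E.
    rewrite unlock; apply: eq_integral => w _.
    rewrite powR_mulrn// -normrX ger0_norm// exprn_even_ge0//.
  rewrite part1// powR_mulrn; last by rewrite divr_ge0 ?mulr_ge0// ltW.
  by congr EFin; rewrite expr0 mulr1 !addr0 -mulrDl.
(* For odd k the positive and negative parts of the integrand are c^k times [ppow k%:R] of S and of
   -S. *)
rewrite unlock integralE.
have ck0 : 0 <= c ^+ k by rewrite exprn_ge0// ltW.
have Sneg (x : R) : x <= 0 -> x ^+ k <= 0.
  by move=> x0; rewrite exprn_odd_le0.
have Spos (x : R) : 0 < x -> x ^+ k = ppow k%:R x.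
  by move=> x0; rewrite ppow_pos// powR_mulrn// ltW.
have posE w : (((fun w => (Zbar w ^+ k)%:E) ^\+) w =
    (c ^+ k)%:E * (ppow k%:R (S w))%:E)%E.
  rewrite funeposE ZbarE exprMn -EFinM -EFin_max; congr EFin.
  have [x0|x0] := ltP 0 (S w).
    by rewrite (Spos (S w))// max_l// mulr_ge0 ?ppow_ge0.
  by rewrite ppow_neg// mulr0 max_r// mulr_ge0_le0// Sneg.
have negE w : (((fun w => (Zbar w ^+ k)%:E) ^\-) w =
    (c ^+ k)%:E * (ppow k%:R (- S w))%:E)%E.
  rewrite funenegE ZbarE exprMn -EFinN -EFinM -EFin_max; congr EFin.
  have [x0|x0] := ltP 0 (- S w).
    rewrite -(Spos (- S w))// exprNn -signr_odd ok expr1 mulN1r mulrN max_l// oppr_ge0.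
    by rewrite mulr_ge0_le0// Sneg// -oppr_ge0 ltW.
  rewrite (ppow_neg _ x0) mulr0 max_r// oppr_le0 mulr_ge0// exprn_ge0//.
  by rewrite -oppr_le0.
under eq_integral do rewrite posE.
under [X in (_ - X)%E]eq_integral do rewrite negE.
have mp : measurable_fun [set: R] (fun x : R => (ppow k%:R x)%:E) by meas.
have mn : measurable_fun [set: R] (fun x : R => (ppow k%:R (- x))%:E) by meas.
rewrite (law (fun x => ((c ^+ k)%:E * (ppow k%:R x)%:E)%E)); last 2 first.
- exact: measurable_funeM.
- by move=> x; rewrite mule_ge0 ?lee_fin ?ppow_ge0.
rewrite (law (fun x => ((c ^+ k)%:E * (ppow k%:R (- x))%:E)%E)); last 2 first.
- exact: measurable_funeM.
- by move=> x; rewrite mule_ge0 ?lee_fin ?ppow_ge0.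
under eq_integral do rewrite -muleA.
under [X in (_ - X)%E]eq_integral do rewrite -muleA.
rewrite ge0_integralZl_EFin//; last 2 first.
- by move=> x _; rewrite mule_ge0 ?lee_fin ?ppow_ge0.
- exact: emeasurable_funM.
rewrite ge0_integralZl_EFin//; last 2 first.
- by move=> x _; rewrite mule_ge0 ?lee_fin ?ppow_ge0.
- exact: emeasurable_funM.
have E := signed_moment rho_gtN1 rho_lt1 k1 p0 pk.
(* Factoring out c^k must exclude +oo - +oo; both integrals are finite because [E] gives their
   difference a real value. *)
rewrite -muleBr//; last first.
  have : (\int[lebesgue_measure]_x ((ppow k%:R x)%:E * vg_pdf rho (N / 2) x) -
    \int[lebesgue_measure]_x ((ppow k%:R (- x))%:E * vg_pdf rho (N / 2) x))%E
    \is a fin_num by rewrite E.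
  by rewrite fin_numB => /andP[_ fin]; rewrite fin_num_adde_defl// fin_numN.
rewrite E -EFinM; congr EFin.
rewrite expr1 -addrA.
rewrite (_ : c = 2 * s / N * (1 - rho ^+ 2)); last first.
  by rewrite /c /tau mulrAC.
rewrite exprMn powRD; last by rewrite (gt_eqF rho2) implybT.
rewrite powR_mulrn ?(ltW rho2)//.
ring.
Qed.
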